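(* Let $1<p<\infty$, let $q$ be the conjugate index of $p$, and let $\omega$ be an almost monotone algebra weight on $\mathbb{Z}$. Let $\mathcal{A}$ be a unital Banach algebra, $f \in C(\mathbb{T},\mathcal{A})$, and suppose $f$ has $p$-th power $\omega$-absolutely convergent Fourier series. If $f(z)$ is left invertible (respectively, right invertible, invertible) in $\mathcal A$ for all $z \in \mathbb{T}$, then there exist an almost monotone algebra weight $\nu$ on $\mathbb{Z}$ and $g \in C(\mathbb{T},\mathcal{A})$ such that (i) $1 \leq \nu \leq K\omega$ for some $K>0$; (ii) $g$ has $p$-th power $\nu$-absolutely convergent Fourier series; (iii) $g$ is a left inverse (respectively, right inverse, inverse) of $f$. In particular, if $\omega$ is an admissible weight, then a left inverse (respectively, right inverse, inverse) of $f$ has $p$-th power $\omega$-absolutely convergent Fourier series.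
   Context: All algebras are complex. $\mathbb{T}=\{z\in\mathbb{C}:|z|=1\}$; $C(\mathbb{T},\mathcal{A})$ is the set of continuous functions $\mathbb{T}\to\mathcal{A}$ (an algebra under pointwise operations; inverses of $f$ are with respect to pointwise multiplication). $\|\cdot\|$ is the norm of $\mathcal{A}$. $\mathbb N=\{1,2,\dots\}$, $\mathbb{N}_0=\mathbb{N}\cup\{0\}$. The conjugate index $q$ satisfies $\frac1p+\frac1q=1$. A weight on $\mathbb{Z}$ is a map $\omega:\mathbb{Z}\to[1,\infty)$ with $\omega(m+n)\leq\omega(m)\omega(n)$ for all $m,n\in\mathbb{Z}$. Put $\rho_{1,\omega}=\sup\{\omega(-n)^{-1/n}:n\in\mathbb{N}\}$ and $\rho_{2,\omega}=\inf\{\omega(n)^{1/n}:n\in\mathbb{N}\}$; $\omega$ is admissible if $\rho_{1,\omega}=1=\rho_{2,\omega}$. A weight $\omega$ on $\mathbb{Z}$ is an almost monotone algebra weight (relative to $q$) if: (1) $\omega^{-q}\star\omega^{-q}\leq\omega^{-q}$ (where $\star$ is convolution on $\mathbb{Z}$) and $\sum_{n\in\mathbb{Z}}\omega(n)^{-q}<\infty$; (2) if $\rho_{1,\omega}=1$, then there is $K>0$ such that $\omega(n)\leq K\omega(n+k)$ for all $n,k$ with $-n,-k\in\mathbb{N}$; (3) if $\rho_{2,\omega}=1$, then there is $K>0$ such that $\omega(n)\leq K\omega(n+k)$ for all $n,k\in\mathbb{N}_0$. The Fourier coefficients of $f\in C(\mathbb{T},\mathcal{A})$ are $\widehat f(n)=\frac{1}{2\pi}\int_0^{2\pi}f(e^{it})e^{-int}\,dt\in\mathcal{A}$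 ($n\in\mathbb{Z}$). $f\in C(\mathbb{T},\mathcal{A})$ has $p$-th power $\omega$-absolutely convergent Fourier series if $f(z)=\sum_{n\in\mathbb{Z}}\widehat f(n)z^n$ for all $z\in\mathbb{T}$ and $\sum_{n\in\mathbb{Z}}\|\widehat f(n)\|^p\omega(n)^p<\infty$. *)

(* Defs.v *)
From HB Require Import structures.
From mathcomp Require Import all_boot all_order all_algebra.
From mathcomp Require Import all_classical all_reals all_analysis.
From mathcomp Require Import complex.

Set Implicit Arguments.
Unset Strict Implicit.
Unset Printing Implicit Defensive.

Import Order.TTheory GRing.Theory Num.Theory numFieldNormedType.Exports.

Local Open Scope classical_set_scope.
Local Open Scope ring_scope.
Local Open Scope complex_scope.

(* Complex unital Banach algebras, with 1 <> 0 as for every algType; the unit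
   is not required to have norm 1.  Hierarchy-Builder rejects a common
   substructure of algType and completeNormedModType (it would have to be
   declared below numDomainType), so the multiplication is bundled with the
   Banach space and the algebra structure is inferred on the carrier. *)
Record banachAlgebra (R : realType) := BanachAlgebra {
  banach_space : completeNormedModType R[i];
  bone : banach_space;
  bmul : banach_space -> banach_space -> banach_space;
  bmulA : associative bmul;
  bmul1r : left_id bone bmul;
  bmulr1 : right_id bone bmul;
  bmulDl : left_distributive bmul +%R;
  bmulDr : right_distributive bmul +%R;
  bone_neq0 : bone != 0;
  bscaleAl : forall (c : R[i]) (x y : banach_space),
    c *: bmul x y = bmul (c *: x) y;
  bscaleAr : forall (c : R[i]) (x y : banach_space),
    c *: bmul x y = bmul x (c *: y);
  bnormM : forall x y : banach_space, `|bmul x y| <= `|x| * `|y|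
}.

Definition banach_sort (R : realType) (A : banachAlgebra R) : Type :=
  banach_space A.
Coercion banach_sort : banachAlgebra >-> Sortclass.

Section BanachAlgebraInstances.
Variables (R : realType) (A : banachAlgebra R).

HB.instance Definition _ :=
  CompleteNormedModule.copy (banach_sort A) (banach_space A).
HB.instance Definition _ := GRing.Zmodule_isNzRing.Build (banach_sort A)
  (@bmulA R A) (@bmul1r R A) (@bmulr1 R A) (@bmulDl R A) (@bmulDr R A)
  (@bone_neq0 R A).
HB.instance Definition _ := GRing.Lmodule_isLalgebra.Build R[i] (banach_sort A)
  (@bscaleAl R A).
HB.instance Definition _ := GRing.Lalgebra_isAlgebra.Build R[i] (banach_sort A)
  (@bscaleAr R A).

End BanachAlgebraInstances.

Lemma banach_normM (R : realType) (A : banachAlgebra R) (x y : A) :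
  `|x * y| <= `|x| * `|y|.
Proof. exact: bnormM. Qed.

Section Weights.
Variable R : realType.
Implicit Types (w : int -> R) (q : R).

Definition weight w :=
  (forall n, 1 <= w n) /\ (forall m n, w (m + n) <= w m * w n).

Definition rho1 w : R :=
  sup [set w (- n%:Z) `^ (- n%:R^-1) | n in [set n : nat | (0 < n)%N]].

Definition rho2 w : R :=
  inf [set w n%:Z `^ (n%:R^-1) | n in [set n : nat | (0 < n)%N]].

Definition admissible w := rho1 w = 1 /\ rho2 w = 1.

Definition almost_monotone_algebra_weight q w :=
  [/\ weight w,
      (forall n : int,
         (\esum_(k in [set: int]) (w k `^ (- q) * w (n - k) `^ (- q))%:E
            <= (w n `^ (- q))%:E)%E) /\
      (\esum_(n in [set: int]) (w n `^ (- q))%:E < +oo)%E,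
      rho1 w = 1 -> exists2 K : R, 0 < K &
        forall n k : int, n < 0 -> k < 0 -> w n <= K * w (n + k) &
      rho2 w = 1 -> exists2 K : R, 0 < K &
        forall n k : int, 0 <= n -> 0 <= k -> w n <= K * w (n + k)].

End Weights.

(* The norm of a normed module over R[i] is a nonnegative real element of
   R[i]; this is the same number as an element of R. *)
Definition rnorm (R : realType) (V : normedModType R[i]) (x : V) : R :=
  complex.Re `|x|.

Section RiemannIntegral.
Variables (R : realType) (V : normedModType R[i]).
Implicit Types (a b : R) (F : R -> V) (I : V).

(* The partition a = t_0 < ... < t_m = b is given by s = [:: t_1; ...; t_m],
   and xi i is the tag of the subinterval [t_i, t_(i+1)]. *)
Definition is_riemann_integral a b F I :=
  forall e : R, 0 < e -> exists2 d : R, 0 < d &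
    forall (s : seq R) (xi : nat -> R), itv_partition a b s ->
      (forall i, (i < size s)%N ->
         [/\ nth b (a :: s) i <= xi i, xi i <= nth b s i &
             nth b s i - nth b (a :: s) i < d]) ->
      rnorm (\sum_(i < size s)
               (nth b s i - nth b (a :: s) i)%:C *: F (xi i) - I) < e.

(* Takes the value 0 when F is not Riemann integrable. *)
Definition riemann_integral a b F : V := xget 0 (is_riemann_integral a b F).

End RiemannIntegral.

Section FourierSeries.
Variables (R : realType) (A : banachAlgebra R).

Definition circle : set R[i]^o := [set z | `|z| = 1].

Definition expi (t : R) : R[i] := cos t +i* sin t.

(* An element of C(T, A) is represented by a function on R[i] whose restriction
   to the circle is continuous; its values elsewhere are irrelevant. *)
Definition continuous_on_circle (f : R[i] -> A) :=
  {within circle, continuous f}.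

Definition fourier_coef (f : R[i] -> A) (n : int) : A :=
  ((2 * pi)^-1)%:C *: riemann_integral 0 (2 * pi)
    (fun t => expi (- (n%:~R * t)) *: f (expi t)).

(* The terms of index -N, ..., N. *)
Definition fourier_partial_sum (f : R[i] -> A) (z : R[i]) (N : nat) : A :=
  \sum_(k < N.*2.+1) z ^ (k%:Z - N%:Z) *: fourier_coef f (k%:Z - N%:Z).

Definition abs_conv_fourier (p : R) (w : int -> R) (f : R[i] -> A) :=
  (forall z, circle z -> fourier_partial_sum f z @ \oo --> f z) /\
  (\esum_(n in [set: int])
     (rnorm (fourier_coef f n) `^ p * w n `^ p)%:E < +oo)%E.

End FourierSeries.

Variant side := LeftSide | RightSide | TwoSided.

Definition is_inverse (T : nzRingType) (s : side) (a b : T) : Prop :=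
  match s with
  | LeftSide => b * a = 1
  | RightSide => a * b = 1
  | TwoSided => b * a = 1 /\ a * b = 1
  end.

(* Main.v *)
Require Import Defs.
From mathcomp Require Import all_boot all_order all_algebra.
From mathcomp Require Import all_classical all_reals all_analysis.
From mathcomp Require Import complex.
From mathcomp Require Import ring lra zify.
Import Order.TTheory GRing.Theory Num.Theory numFieldNormedType.Exports.
Local Open Scope classical_set_scope.
Local Open Scope ring_scope.
Local Open Scope complex_scope.

Set Implicit Arguments.
Unset Strict Implicit.
Unset Printing Implicit Defensive.

Local Notation nc := Normc.normc.

(* The functions with Fourier coefficients in l^p(w) form a Banach algebra [T]
   under pointwise multiplication.  If [w] is admissible, then the powers of the
   central element [u : z |-> z] and of its inverse have subexponential norms.
   If [w] is not admissible, it dominates a weight of the form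
   [n |-> c * v |n|] with [v] subexponential.  Hence both claims reduce to an
   inversion theorem in [T] for subexponential weights.

   For that theorem no maximal ideals are needed.  Approximating [F] by
   trigonometric polynomials, the left inverse of [F (m^-1)] with [|m| = 1] gives
   [b] with [b * (1 - m u)] in [1 + T F].  Perturbing [b], the true inverses
   [X_k] and [X'_k] of [1 - r zeta_k u] and [1 - r^-1 zeta_k u] differ by an
   element of [T F] up to a small error that is uniform in the point [zeta_k] of
   the circle, by compactness.  Averaging over the n-th roots of unity [zeta_k]
   gives [(1 - (r u)^n)^-1 - (1 - (u / r)^n)^-1], which tends to 1 as n grows.
   Hence [T F] contains an element close to 1, and [F] is left invertible in [T].
   The converse ring takes care of right inverses. *)

(** * Unit complex numbers *)

(** The averaging is a discrete form of Cauchy's integral. Subexponential growth puts the spectrum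
    of [u] on the circle, so the resolvents on both sides of it exist, and their averages differ by
    an element close to 1. Modulo the left ideal T F the resolvent continues across the circle,
    because b (1 - m u) lies in 1 + T F; this is why the two averages differ by little modulo T F.
    The inverses X_k and X'_k themselves blow up as r tends to 1, so only their parts outside the
    ideal, built from b, can be compared. The ideal is one-sided and need not be closed, so
    membership is tracked with explicit errors instead of in a quotient algebra. For a weight that
    is not admissible the spectrum of [u] may be a genuine annulus, while F is invertible only on
    the circle; this forces the passage to a smaller weight. If one half of [w] is subexponential,
    its almost monotonicity allows it to be copied to the other half without losing the convolution
    inequality. *)

Section ComplexModulus.
Variable R : realType.
Implicit Types (z : R[i]) (r t : R).

Lemma normc_ge0 z : 0 <= nc z.
Proof. by case: z => a b /=; rewrite sqrtr_ge0. Qed.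

Lemma normc_realE r : nc r%:C = `|r|.
Proof. by rewrite /= expr0n /= addr0 sqrtr_sqr. Qed.

Lemma normc_le_abs z : nc z <= `|complex.Re z| + `|complex.Im z|.
Proof.
case: z => a b /=.
rewrite -(ger0_norm (addr_ge0 (normr_ge0 a) (normr_ge0 b))) -sqrtr_sqr.
rewrite ler_wsqrtr // sqrrD !real_normK ?num_real //.
by rewrite addrAC lerDl mulrn_wge0 ?mulr_ge0 ?normr_ge0.
Qed.

Lemma expiD s t : expi (s + t) = expi s * expi t.
Proof.
apply/eqP; rewrite eq_complex /= cosD sinD eqxx /=.
by rewrite [X in _ == X]addrC.
Qed.

Lemma expi0 : expi 0 = 1 :> R[i].
Proof. by rewrite /expi cos0 sin0. Qed.

Lemma expi_natmul t n : expi (t *+ n) = expi t ^+ n.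
Proof. by elim: n => [|n IH]; rewrite ?expi0 // mulrS exprS expiD IH. Qed.

Lemma normc_expi t : nc (expi t) = 1.
Proof. by rewrite /= cos2Dsin2 sqrtr1. Qed.

Lemma expi_neq0 t : expi t != 0.
Proof. by apply: contra_eq_neq (normc_expi t) => ->; rewrite Normc.normc0 eq_sym oner_neq0. Qed.

Lemma expiN t : expi (- t) = (expi t)^-1.
Proof.
apply: (mulfI (expi_neq0 t)); rewrite -expiD subrr expi0 mulfV //.
exact: expi_neq0.
Qed.

Lemma expi_intmul t (n : int) : expi (n%:~R * t) = expi t ^ n.
Proof.
case: n => n; first by rewrite -pmulrn mulr_natl expi_natmul -exprnP.
by rewrite NegzE mulrNz mulNr expiN -pmulrn mulr_natl expi_natmul exprnN.
Qed.

Lemma expi_2pi : expi (2 * pi) = 1 :> R[i].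
Proof. by rewrite /expi mulr_natl cos2pi sin2pi. Qed.

(** Half-angle formula: cos t = 1 - 2 sin^2 (t / 2), and sin is positive at t / 2. *)
Lemma expi_eq1 t : 0 < t < 2 * pi -> expi t != 1.
Proof.
move=> /andP[t0 t2]; apply/eqP => -[]; have -> : t = (t / 2) *+ 2 by lra.
rewrite cos_mulr2n cos2sin2 => h _.
have : 0 < sin (t / 2) by apply: sin_gt0_pi; lra.
suff : sin (t / 2) ^+ 2 = 0 by move/eqP; rewrite sqrf_eq0 => /eqP ->; rewrite ltxx.
by move: h; lra.
Qed.

Definition unity_arg (n k : nat) : R := 2 * pi * k%:R / n%:R.

Lemma unity_arg_itv n k : (k < n)%N -> 0 <= unity_arg n k <= 2 * pi.
Proof.
move=> kn; have n0 : 0 < n%:R :> R by rewrite ltr0n (leq_ltn_trans _ kn).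
have p0 : 0 < 2 * pi :> R by rewrite mulr_gt0 // pi_gt0.
apply/andP; split; first by apply: divr_ge0; [apply: mulr_ge0; [exact: ltW|]|exact: ltW].
by rewrite ler_pdivrMr // ler_pM2l // ler_nat ltnW.
Qed.

Lemma expi_unity_arg n k : (0 < n)%N -> expi (unity_arg n k) ^+ n = 1.
Proof.
move=> n0; rewrite -expi_natmul /unity_arg -[_ *+ n]mulr_natr.
rewrite divfK ?pnatr_eq0 -?lt0n // mulr_natr.
by rewrite expi_natmul expi_2pi expr1n.
Qed.

(** Since zeta_k^j = zeta_j^k, this is a geometric sum whose ratio zeta_j is an n-th root of unity
    other than 1. *)
Lemma sum_unity_roots n j : (0 < j < n)%N ->
  \sum_(k < n) expi (unity_arg n k) ^+ j = 0 :> R[i].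
Proof.
move=> /andP[j0 jn]; have n0 : (0 < n)%N by exact: leq_ltn_trans jn.
have nr0 : 0 < n%:R :> R by rewrite ltr0n.
have p0 : 0 < 2 * pi :> R by rewrite mulr_gt0 // pi_gt0.
set z := expi (unity_arg n j).
have -> : \sum_(k < n) expi (unity_arg n k) ^+ j = \sum_(k < n) z ^+ k.
  apply: eq_bigr => k _; rewrite /z -!expi_natmul; congr expi.
  by rewrite -[LHS]mulr_natr -[RHS]mulr_natr /unity_arg mulrAC mulrC; ring.
have z1 : z != 1.
  apply: expi_eq1; rewrite /unity_arg divr_gt0 ?mulr_gt0 ?ltr0n ?pi_gt0 //=.
  by rewrite ltr_pdivrMr // ltr_pM2l // ltr_nat.
apply: (mulfI (_ : z - 1 != 0)); first by rewrite subr_eq0.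
by rewrite mulr0 -subrX1 expi_unity_arg ?subrr.
Qed.

Lemma expi_continuous_near (t0 e : R) : 0 < e ->
  \forall t \near t0, nc (expi t - expi t0) < e.
Proof.
move=> e0; have e2 : 0 < e / 2 by rewrite divr_gt0.
have /cvgrPdist_lt/(_ _ e2) hc := @continuous_cos R t0.
have /cvgrPdist_lt/(_ _ e2) hs := @continuous_sin R t0.
near=> t; apply: le_lt_trans (normc_le_abs _) _; rewrite /= [e]splitr.
by apply: ltrD; rewrite distrC; near: t.
Unshelve. all: by end_near. Qed.

End ComplexModulus.

(** * From local to global left inverses *)

(* [bnd x c] stands for the inequality [|x| <= c] of a norm that need not be
   defined on all of [T], and [sc] for the embedding of the scalars. *)
Record bounded_ring (R : realType) (T : nzRingType) (bnd : T -> R -> Prop)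
    (sc : R[i] -> T) : Prop := BoundedRing {
  bnd_ge0 : forall x c, bnd x c -> 0 <= c;
  bnd_le : forall x c d, c <= d -> bnd x c -> bnd x d;
  bndD : forall x y c d, bnd x c -> bnd y d -> bnd (x + y) (c + d);
  bndN : forall x c, bnd x c -> bnd (- x) c;
  bndM : forall x y c d, bnd x c -> bnd y d -> bnd (x * y) (c * d);
  bnd_sc : exists2 M, 0 < M & forall z, bnd (sc z) (M * nc z);
  scB : {morph sc : z t / z - t};
  scM : {morph sc : z t / z * t};
  sc1 : sc 1 = 1;
  sc_comm : forall z x, sc z * x = x * sc z;
  bnd_neumann : exists2 M, 0 < M & forall x c, c < 1 -> bnd x c ->
    exists y, [/\ bnd y (M / (1 - c)), y * (1 - x) = 1 & (1 - x) * y = 1]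
}.

(** The record is self-dual because the scalars are central and the Neumann inverses are
    two-sided. *)
Lemma bounded_ring_converse (R : realType) (T : nzRingType) (bnd : T -> R -> Prop)
    (sc : R[i] -> T) :
  bounded_ring bnd sc -> bounded_ring (T := T^c) bnd sc.
Proof.
case=> h0 hle hD hN hM hsc scB scM sc1 scC [M M0 hn].
split=> //.
- by move=> x y c d hx hy; rewrite mulrC; exact: hM.
- by move=> z t; rewrite mulrC scM.
- by move=> z x; exact/esym/scC.
by exists M => // x c c1 /(hn _ _ c1) [y [? ? ?]]; exists y.
Qed.

Section LocalInverse.
Variables (R : realType) (T : nzRingType) (bnd : T -> R -> Prop).
Variable (sc : R[i] -> T).
Hypothesis (B : bounded_ring bnd sc).
Variables (u v : T).
Hypotheses (u_comm : forall x, u * x = x * u) (uv1 : u * v = 1).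
Hypothesis (bnd_u : exists c, bnd u c).
Hypothesis (growth : forall r e : R, 0 < r < 1 -> 0 < e ->
  exists2 n, (0 < n)%N &
    bnd ((sc r%:C * u) ^+ n) e /\ bnd ((sc r%:C * v) ^+ n) e).
Variables (f : T).

Definition bounded x := exists c, bnd x c.

Lemma boundedD x y : bounded x -> bounded y -> bounded (x + y).
Proof. by move=> [c hc] [d hd]; exists (c + d); exact: (bndD B). Qed.

Lemma boundedN x : bounded x -> bounded (- x).
Proof. by move=> [c hc]; exists c; exact: (bndN B). Qed.

Lemma boundedM x y : bounded x -> bounded y -> bounded (x * y).
Proof. by move=> [c hc] [d hd]; exists (c * d); exact: (bndM B). Qed.

Lemma bounded_sc z : bounded (sc z).
Proof. by have [M _ h] := bnd_sc B; exists (M * nc z). Qed.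

Lemma bounded1 : bounded 1.
Proof. by rewrite -(sc1 B); exact: bounded_sc. Qed.

Lemma bounded0 : bounded 0.
Proof. by rewrite -(subrr 1); apply: boundedD bounded1 (boundedN bounded1). Qed.

Lemma boundedX x n : bounded x -> bounded (x ^+ n).
Proof.
move=> hx; elim: n => [|n IH]; first exact: bounded1.
by rewrite exprS; exact: boundedM.
Qed.

Lemma bounded_sum n (F : 'I_n -> T) : (forall i, bounded (F i)) ->
  bounded (\sum_i F i).
Proof. by move=> h; apply: big_ind => //; [exact: bounded0|exact: boundedD]. Qed.

Lemma sc0 : sc 0 = 0.
Proof. by rewrite -(subrr 0) (scB B) subrr. Qed.

Lemma scD z t : sc (z + t) = sc z + sc t.
Proof. by rewrite -[t in LHS]opprK (scB B) -(sub0r t) (scB B) sc0 sub0r opprK. Qed.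

Lemma sc_sum n (F : 'I_n -> R[i]) : sc (\sum_i F i) = \sum_i sc (F i).
Proof. exact: (big_morph sc scD sc0). Qed.

Lemma scX z n : sc (z ^+ n) = sc z ^+ n.
Proof.
by elim: n => [|n IH]; rewrite ?expr0 ?(sc1 B) // !exprS (scM B) IH.
Qed.

Lemma sc_nat n : sc n%:R = n%:R.
Proof.
by elim: n => [|n IH]; rewrite ?sc0 // -[n.+1]addn1 !natrD scD IH (sc1 B).
Qed.

Lemma v_comm x : v * x = x * v.
Proof.
have vu1 : v * u = 1 by rewrite -u_comm.
by rewrite -[LHS]mulr1 -uv1 mulrA -[v * x * u]mulrA -u_comm !mulrA vu1 mul1r.
Qed.

(** The left ideal is generated over the bounded elements only. An error is enough for the purpose,
    since elements close to 1 are invertible. *)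
Definition near_ideal x e := exists2 g, bounded g & bnd (x - g * f) e.

Lemma near_idealD x y d e :
  near_ideal x d -> near_ideal y e -> near_ideal (x + y) (d + e).
Proof.
move=> [g hg h1] [k hk h2]; exists (g + k); first exact: boundedD.
by rewrite mulrDl opprD addrACA; exact: (bndD B).
Qed.

Lemma near_idealM x y d e : bnd x d -> near_ideal y e -> near_ideal (x * y) (d * e).
Proof.
move=> hx [g hg h]; exists (x * g); first by apply: boundedM => //; exists d.
by rewrite -mulrA -mulrBr; exact: (bndM B).
Qed.

Lemma near_ideal0 e : 0 <= e -> near_ideal 0 e.
Proof.
move=> e0; exists 0; first exact: bounded0.
rewrite mul0r subrr; apply: (bnd_le B e0).
have [M _ /(_ 0)] := bnd_sc B; by rewrite Normc.normc0 mulr0 sc0.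
Qed.

Lemma near_ideal_sum n (F : 'I_n -> T) e : 0 <= e ->
  (forall i, near_ideal (F i) e) -> near_ideal (\sum_i F i) (n%:R * e).
Proof.
move=> e0; elim: n F => [|n IH] F h; first by rewrite big_ord0 mul0r; exact: near_ideal0.
rewrite big_ord_recr /= -natr1 mulrDl mul1r.
by apply: near_idealD => //; apply: IH.
Qed.

(** Here [a] is a left invertible local value of [f]. From f = a + h (1 - m u) + k with [k] small
    one gets b0 f = (1 + b0 k) + b0 h (1 - m u), and the Neumann inverse of 1 + b0 k removes the
    first summand. *)
Lemma local_left_inverse (m : R[i]) :
  (exists b a, [/\ bounded b, b * a = 1 &
     forall e, 0 < e -> exists2 h, bounded h &
       bnd (f - a - h * (1 - sc m * u)) e]) ->
  exists b g, [/\ bounded b, bounded g & b * (1 - sc m * u) = 1 - g * f].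
Proof.
move=> [b0 [a [[c hc] ba h]]]; have c0 := bnd_ge0 B hc.
have [M M0 hn] := bnd_neumann B.
have e0 : 0 < (2 * (c + 1))^-1 by rewrite invr_gt0; lra.
have {h}[h hh] := h _ e0; set k := f - a - _ => hk.
have b0k : bnd (- (b0 * k)) (1/2).
  apply: (bnd_le B) (bndN B (bndM B hc hk)).
  by rewrite ler_pdivrMr; [lra|lra].
have [|y [hy y1 _]] := hn _ _ _ b0k; first by lra.
have bf : b0 * f = 1 + b0 * h * (1 - sc m * u) + b0 * k.
  rewrite -[X in X + _ + _]ba -mulrA -!mulrDr; congr (b0 * _).
  by rewrite /k -[f - a - _]addrA -opprD [RHS]addrC subrK.
exists (- (y * b0 * h)), (y * b0); split.
- by apply/boundedN/boundedM => //; apply: boundedM; [eexists; exact: hy|exists c].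
- by apply: boundedM; [eexists; exact: hy|exists c].
rewrite -[y * b0 * f]mulrA bf [1 + _ + _]addrAC [y * (1 + _ + _)]mulrDr.
move: y1; rewrite opprK => ->.
by rewrite opprD addrA subrr sub0r mulNr !mulrA.
Qed.

(** With [y] the inverse of 1 - (m - m0) b u, the relation for [m0] becomes y b (1 - m u) = 1 - y g
    f, so X = y b + (y g X) f. Modulo the ideal, X - X' is therefore (y - y') b, which the resolvent
    identity bounds by a multiple of |m - m'|. No bound of [X] or [X'] enters [d]. *)
Lemma near_ideal_perturb (m0 : R[i]) b g e : bounded b -> bounded g ->
  b * (1 - sc m0 * u) = 1 - g * f -> 0 < e ->
  exists2 d, 0 < d & forall m m' X X', nc (m - m0) < d -> nc (m' - m0) < d ->
    bounded X -> bounded X' ->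
    X * (1 - sc m * u) = 1 -> X' * (1 - sc m' * u) = 1 ->
    near_ideal (X - X') e.
Proof.
move=> hb hg bE e0; have [c hc] := hb; have [cu hcu] := bnd_u.
have c0 := bnd_ge0 B hc; have cu0 := bnd_ge0 B hcu.
have [M M0 hM] := bnd_sc B; have [N N0 hN] := bnd_neumann B.
(* Distance 1 / K1 makes (m - m0) b u at most 1/2. [K2] is twice the factor of |m - m'| in the final
   estimate, as |m - m'| is at most twice the distance to [m0]; the summands 1 ensure positivity. *)
pose K1 := 2 * (M * (c * cu)) + 1.
pose K2 := 2 * M * (2 * N) * (c * cu) * (2 * N) * c + 1.
have K10 : 0 < K1 by rewrite /K1 ltr_pwDr // !mulr_ge0 // ltW.
have K20 : 0 < K2 by rewrite /K2 ltr_pwDr // !mulr_ge0 // ltW.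
exists (Num.min K1^-1 (e / K2)); first by rewrite lt_min invr_gt0 K10 divr_gt0.
have key m X : nc (m - m0) < Num.min K1^-1 (e / K2) -> bounded X ->
    X * (1 - sc m * u) = 1 ->
    exists y, [/\ bnd y (2 * N), y * (1 - sc (m - m0) * (b * u)) = 1,
      (1 - sc (m - m0) * (b * u)) * y = 1 &
      exists2 k, bounded k & X = y * b + k * f].
  rewrite lt_min => /andP[m1 m2] hX XE.
  have hx : bnd (sc (m - m0) * (b * u)) (1 / 2).
    apply: (bnd_le B) (bndM B (hM _) (bndM B hc hcu)).
    have : nc (m - m0) * K1 <= 1 by rewrite -ler_pdivlMr // mul1r ltW.
    by rewrite /K1; have := normc_ge0 (m - m0); nra.
  have [|y [hy y1 y2]] := hN _ _ _ hx; first lra.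
  exists y; split => //.
    by apply: (bnd_le B) hy; rewrite ler_pdivrMr; [lra|lra].
  have uX z : (1 - sc m * u) * z = z * (1 - sc m * u).
    by rewrite mulrBl mulrBr mul1r mulr1 -mulrA u_comm !mulrA (sc_comm B).
  (* A left inverse of a central element is itself central. *)
  have XC z : z * X = X * z.
    rewrite -[RHS]mulr1 -[in RHS](_ : (1 - sc m * u) * X = 1) ?uX //.
    by rewrite -!mulrA [z * (_ * _)]mulrA -uX !mulrA XE mul1r.
  have bm : y * b * (1 - sc m * u) = 1 - y * g * f.
    have -> : sc m = sc m0 + sc (m - m0) by rewrite -scD addrC subrK.
    rewrite mulrDl opprD addrA -mulrA mulrBr bE addrAC.
    rewrite [b * (_ * u)]mulrA -(sc_comm B) -[_ * b * u]mulrA mulrBr y1 !mulrA //.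
  exists (y * g * X); first by do !apply: boundedM => //; exists (N / (1 - 1 / 2)).
  rewrite -mulrA -XC mulrA.
  have : y * b * (1 - sc m * u) * X = (1 - y * g * f) * X by rewrite bm.
  by rewrite -mulrA uX XE mulr1 mulrBl mul1r => ->; rewrite subrK.
move=> m m' X X' hm hm' hX hX' XE XE'.
have [y [hy y1 y2 [k hk ->]]] := key _ _ hm hX XE.
have [y' [hy' y1' y2' [k' hk' ->]]] := key _ _ hm' hX' XE'.
exists (k - k'); first by apply: boundedD => //; exact: boundedN.
have -> : y * b + k * f - (y' * b + k' * f) - (k - k') * f = (y - y') * b.
  by rewrite !mulrBl opprD addrACA -[X in _ - X]/(_) addrK.
have -> : y - y' = y * (sc (m - m') * (b * u)) * y'.
  have -> : sc (m - m') * (b * u) = (1 - sc (m' - m0) * (b * u)) - (1 - sc (m - m0) * (b * u)).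
    have -> : m - m' = (m - m0) - (m' - m0) by ring.
    by rewrite (scB B) mulrBl opprB [RHS]addrC addrA subrK.
  by rewrite mulrBr mulrBl y1 mul1r -mulrA y2' mulr1.
have nm : nc (m - m') <= 2 * (e / K2).
  have -> : m - m' = (m - m0) + - (m' - m0) by ring.
  apply: le_trans (le_normcD _ _) _; rewrite normcN.
  move: hm hm'; rewrite !lt_min => /andP[_ h1] /andP[_ h2]; lra.
apply: (bnd_le B) (bndM B (bndM B (bndM B hy (bndM B (hM _) (bndM B hc hcu))) hy') hc).
have : e / K2 * K2 = e by rewrite divfK ?gt_eqF.
have : 0 < e / K2 by rewrite divr_gt0.
rewrite /K2; move: (e / K2) nm (normc_ge0 (m - m')) => d.
move: (nc _) => x xd x0 d0 <-.
have P0 : 0 <= M * (2 * N) * (c * cu) * (2 * N) * c by rewrite !mulr_ge0 // ltW.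
suff : M * (2 * N) * (c * cu) * (2 * N) * c * x <=
    M * (2 * N) * (c * cu) * (2 * N) * c * (2 * d) by lra.
exact: ler_wpM2l.
Qed.

Hypothesis local : forall t : R, exists b a, [/\ bounded b, b * a = 1 &
  forall e, 0 < e -> exists2 h, bounded h &
    bnd (f - a - h * (1 - sc (expi t) * u)) e].

(** Both r and 1/r tend to 1 from the two sides, so near each point of the circle
    [near_ideal_perturb] applies to r zeta and zeta / r once r is close to 1. *)
Lemma near_ideal_uniform e : 0 < e ->
  exists2 r : R, 0 < r < 1 & forall t X X', 0 <= t <= 2 * pi ->
    bounded X -> bounded X' ->
    X * (1 - sc (r%:C * expi t) * u) = 1 ->
    X' * (1 - sc (r^-1%:C * expi t) * u) = 1 ->
    near_ideal (X - X') e.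
Proof.
move=> e0; pose P (r t : R) := forall X X', bounded X -> bounded X' ->
  X * (1 - sc (r%:C * expi t) * u) = 1 ->
  X' * (1 - sc (r^-1%:C * expi t) * u) = 1 -> near_ideal (X - X') e.
suff : \forall r \near (1:R)^'-, `[0, 2 * pi] `<=` P r.
  move=> h; near (1:R)^'- => r; exists r; last first.
    move=> t X X' ht; have : P r t by apply: (near h r); rewrite //= in_itv.
    exact.
  by apply/andP; split; near: r; [exact: nbhs_left_gt|exact: nbhs_left_lt].
(* Compactness in near-covering form turns the local choices of [r] into one choice for the whole
   segment. *)
apply: (compact_near_coveringP `[0, 2 * pi]).1; first exact: segment_compact.
move=> t _.
have [b [g [hb hg bE]]] := local_left_inverse (local t).
have [d d0 hd] := near_ideal_perturb hb hg bE e0.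
have d2 : 0 < d / 2 by rewrite divr_gt0.
have r1 : \forall r \near (1:R)^'-, `|r - 1| < d / 2.
  have /cvgrPdist_lt/(_ _ d2) h : x @[x --> (1:R)^'-] --> (1 : R).
    by apply: cvg_at_left_filter; exact: cvg_id.
  by near=> r; rewrite distrC; near: r.
have r2 : \forall r \near (1:R)^'-, `|r^-1 - 1| < d / 2.
  have /cvgrPdist_lt/(_ _ d2) h : x^-1 @[x --> (1:R)^'-] --> (1^-1 : R).
    by apply: cvg_at_left_filter; apply: cvgV => //; exact: cvg_id.
  near=> r; rewrite distrC -[X in `|X - _|]invr1; near: r; exact: h.
have ht := expi_continuous_near t d2.
have key (r t' : R) : `|r - 1| < d / 2 -> nc (expi t' - expi t) < d / 2 ->
    nc (r%:C * expi t' - expi t) < d.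
  move=> h1 h2; have -> : r%:C * expi t' - expi t = (r - 1)%:C * expi t' + (expi t' - expi t).
    by rewrite rmorphB /= rmorph1; ring.
  apply: le_lt_trans (le_normcD _ _) _.
  by rewrite Normc.normcM normc_realE normc_expi mulr1; lra.
near=> t' r.
have h1 : `|r - 1| < d / 2 by near: r; exact: r1.
have h2 : `|r^-1 - 1| < d / 2 by near: r; exact: r2.
have h3 : nc (expi t' - expi t) < d / 2 by near: t'; exact: ht.
by move=> X X'; apply: hd; exact: key.
Unshelve. all: by end_near. Qed.

(** Orthogonality of the roots of unity leaves only j = 0. Together with the next lemma, the
    inverses of 1 - zeta_k w have average (1 - w^n)^-1. *)
Lemma sum_root_of_unity_powers n w : (0 < n)%N ->
  \sum_(k < n) \sum_(j < n) (sc (expi (unity_arg R n k)) * w) ^+ j = n%:R.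
Proof.
case: n => // n _; rewrite exchange_big big_ord_recl /=.
rewrite (eq_bigr (fun=> 1)) => [|i _]; last by rewrite expr0.
rewrite sumr_const card_ord big1 ?addr0 // => j _.
rewrite (eq_bigr (fun k : 'I_n.+1 => sc (expi (unity_arg R n.+1 k) ^+ bump 0 j) * w ^+ bump 0 j)).
  2: by move=> k _; rewrite scX exprMn_comm //; exact: (sc_comm B).
rewrite -mulr_suml.
by rewrite -sc_sum sum_unity_roots ?sc0 ?mul0r //= /bump /= add1n ltnS.
Qed.

(** The geometric sum in x = zeta_k w times 1 - x is 1 - x^n, and x^n = w^n. *)
Lemma root_of_unity_inverse n k w Y : (k < n)%N -> Y * (1 - w ^+ n) = 1 ->
  Y * (\sum_(j < n) (sc (expi (unity_arg R n k)) * w) ^+ j)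
    * (1 - sc (expi (unity_arg R n k)) * w) = 1.
Proof.
move=> kn YE; set x := sc _ * w.
have xn : x ^+ n = w ^+ n.
  rewrite /x exprMn_comm; last exact: (sc_comm B).
  by rewrite -scX expi_unity_arg ?(sc1 B) ?mul1r // (leq_ltn_trans _ kn).
have -> : Y * (\sum_(j < n) x ^+ j) * (1 - x) = Y * (1 - x ^+ n).
  rewrite -mulrA; congr (_ * _).
  have c : GRing.comm (\sum_(j < n) x ^+ j) (1 - x).
    apply: commrB; first exact: commr1.
    by apply: commr_sym; apply: commr_sum => i _; apply: commrX.
  by rewrite c -opprB mulNr -subrX1 opprB.
by rewrite xn.
Qed.

Theorem left_inverse_of_local : exists2 g, bounded g & g * f = 1.
Proof.
have [M M0 hM] := bnd_sc B; have [N N0 hN] := bnd_neumann B.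
(* [e] and [d] make each of the two terms of [z] below at most 1/4: [1 - s] is bounded by M + 1/2,
   the averaged ideal error by M e, and [s' * y] by 2 N d. *)
pose e : R := (4 * (M + 1) * M)^-1.
have e0 : 0 < e by rewrite invr_gt0 !mulr_gt0 // addr_gt0.
have [r r01 hr] := near_ideal_uniform e0.
pose d : R := Num.min (1/2) (8 * (M + 1) * N)^-1.
have d0 : 0 < d by rewrite lt_min invr_gt0 !mulr_gt0 ?addr_gt0 //; lra.
have [n n0 [hs hs']] := growth r01 d0.
set s := _ ^+ n in hs; set s' := _ ^+ n in hs'.
have dh : d <= 1 / 2 by rewrite ge_min lexx.
have [|Y [hY Y1 Y2]] := hN _ _ _ hs; first lra.
have [|y [hy y1 _]] := hN _ _ _ hs'; first lra.
have [r0 r1] : 0 < r /\ r < 1 by apply/andP.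
pose w := sc r%:C * u; pose w' := sc r^-1%:C * u.
pose v0 := sc r%:C * v.
have rr : sc r^-1%:C * sc r%:C = 1.
  by rewrite -(scM B) -rmorphM mulVf ?gt_eqF // rmorph1 (sc1 B).
have v0C x : GRing.comm x v0.
  by rewrite /GRing.comm /v0 -mulrA v_comm !mulrA (sc_comm B).
have s'C x : s' * x = x * s' by rewrite (commrX n (v0C x)).
have wv : w' * v0 = 1.
  by rewrite /w' /v0 -mulrA u_comm -[_ * v * u]mulrA v_comm uv1 mulr1.
have ss' : w' ^+ n * s' = 1 by rewrite -exprMn_comm // wv expr1n.
(* The powers of w' = u / r may be large, so 1 - w'^n is inverted through s' = (r v)^n, the inverse
   of w'^n: 1 - w'^n = - w'^n (1 - s'). This also shows that [Y'] is small. *)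
pose Y' := - (s' * y).
have Y'1 : Y' * (1 - w' ^+ n) = 1.
  rewrite /Y' mulrBr mulr1 !mulNr opprK s'C -mulrA s'C ss' mulr1.
  by rewrite -[LHS]opprK opprD opprK -[X in _ - X]mulr1 -mulrBr -mulrN opprB.
have by_ : bounded y by exists (N / (1 - d)).
have bY : bounded Y by exists (N / (1 - d)).
have bs' : bounded s' by exists d.
have bsum (z : T) k : bounded z -> bounded (\sum_(j < n) (sc (expi (unity_arg R n k)) * z) ^+ j).
  by move=> bz; apply: bounded_sum => i; apply/boundedX/boundedM => //; exact: bounded_sc.
have bw (x : R) : bounded (sc x%:C * u) by apply: boundedM => //; exact: bounded_sc.
pose S z k := \sum_(j < n) (sc (expi (unity_arg R n k)) * z) ^+ j.
have hk (k : 'I_n) : near_ideal (Y * S w k - Y' * S w' k) e.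
  apply: (hr (unity_arg R n k)).
  - exact: unity_arg_itv.
  - exact: boundedM bY (bsum _ _ (bw _)).
  - exact: boundedM (boundedN (boundedM bs' by_)) (bsum _ _ (bw _)).
  - rewrite [_%:C * _]mulrC (scM B) -[sc _ * sc _ * u]mulrA.
    exact: root_of_unity_inverse (ltn_ord k) Y1.
  - rewrite [_%:C * _]mulrC (scM B) -[sc _ * sc _ * u]mulrA.
    exact: root_of_unity_inverse (ltn_ord k) Y'1.
have := near_ideal_sum (ltW e0) hk.
rewrite big_split /= sumrN -!mulr_sumr !sum_root_of_unity_powers // -mulrBl.
(* Division by n cancels the factor n of the accumulated error, so the error of the average does not
   depend on n. *)
move=> hn; have {hn} := near_idealM (hM n%:R^-1) hn.
have n0' : 0 < n%:R :> R by rewrite ltr0n.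
have -> : sc n%:R^-1 * ((Y - Y') * n%:R) = Y - Y'.
  rewrite -sc_nat (sc_comm B) -mulrA -(scM B) mulfV ?(sc1 B) ?mulr1 //.
  by rewrite pnatr_eq0 -lt0n.
have -> : M * nc n%:R^-1 * (n%:R * e) = M * e.
  rewrite Normc.normcV -(rmorph_nat (real_complex R)) normc_realE ger0_norm //.
  rewrite -mulrA mulKf ?gt_eqF //.
move=> [g hg hge].
have hd : bnd (1 - s) (M + 1/2).
  apply: (bndD B); last by apply: (bnd_le B) (bndN B hs).
  by have := hM 1; rewrite (sc1 B) Normc.normc1 mulr1.
(* Since Y' = - s' y and (1 - s) Y = 1, this is 1 - (1 - s) g f; as it is small, (1 - s) g f has a
   left inverse. *)
pose z := (1 - s) * (Y - Y' - g * f) - (1 - s) * (s' * y).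
have hz : bnd z (3/4).
  apply: (bnd_le B) (bndD B (bndM B hd hge) (bndN B (bndM B hd (bndM B hs' hy)))).
  rewrite (mulrA d); set P := M + 1/2; set F := M / _.
  have P0 : 0 < P by rewrite addr_gt0.
  have -> : P * (M * e) = P / (M + 1) / 4.
    by rewrite /e; field; rewrite !gt_eqF // addr_gt0.
  have h1 : P / (M + 1) <= 1 by rewrite ler_pdivrMr /P; lra.
  have h2 : d * (8 * (M + 1) * N) <= 1.
    by rewrite -ler_pdivlMr ?mul1r ?ge_min ?lexx ?orbT // !mulr_gt0 // addr_gt0.
  have h3 : N / (1 - d) <= 2 * N by rewrite ler_pdivrMr; [nra|lra].
  have h4 : d * (N / (1 - d)) <= d * (2 * N) by rewrite ler_pM2l.
  have h5 : P * (d * (N / (1 - d))) <= P * (d * (2 * N)) by rewrite ler_pM2l.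
  have h6 : P * (d * (2 * N)) <= (M + 1) * (d * (2 * N)).
    by rewrite ler_pM2r ?mulr_gt0 // /P; lra.
  have h7 : (M + 1) * (d * (2 * N)) = d * (8 * (M + 1) * N) / 4 by field.
  lra.
have [|x [hx x1 _]] := hN _ _ _ hz; first lra.
exists (x * (1 - s) * g).
  apply: boundedM => //; apply: boundedM; first by exists (N / (1 - 3/4)).
  by exists (M + 1/2).
rewrite -[RHS]x1 -!mulrA; congr (_ * _).
rewrite /z mulrBr mulrBr Y2 /Y' mulrN opprK.
by rewrite [_ + _ - _ - _]addrAC addrK subKr.
Qed.

End LocalInverse.

(** * Unconditional sums *)

Section RealNorm.
Variables (R : realType) (V : normedModType R[i]).
Implicit Types x y : V.

Lemma normE x : `|x| = (rnorm x)%:C.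
Proof. by rewrite /rnorm RRe_real // ger0_real. Qed.

Lemma rnorm_ge0 x : 0 <= rnorm x.
Proof. by rewrite -ler0c -normE. Qed.

Lemma rnorm0 : rnorm (0 : V) = 0.
Proof. by rewrite /rnorm normr0. Qed.

Lemma rnorm0_eq0 x : rnorm x = 0 -> x = 0.
Proof. by move=> h; apply/eqP; rewrite -normr_eq0 normE h. Qed.

Lemma rnormD x y : rnorm (x + y) <= rnorm x + rnorm y.
Proof. by rewrite -lecR rmorphD /= -!normE ler_normD. Qed.

Lemma rnormN x : rnorm (- x) = rnorm x.
Proof. by rewrite /rnorm normrN. Qed.

Lemma rnormB x y : rnorm (x - y) <= rnorm x + rnorm y.
Proof. by rewrite -(rnormN y) rnormD. Qed.

Lemma rdistC x y : rnorm (x - y) = rnorm (y - x).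
Proof. by rewrite -rnormN opprB. Qed.

Lemma rnormZ (c : R[i]) x : rnorm (c *: x) = nc c * rnorm x.
Proof. by apply: complexI; rewrite rmorphM /= -!normE normrZ. Qed.

Lemma rnorm_sum (I : Type) (s : seq I) (F : I -> V) :
  rnorm (\sum_(i <- s) F i) <= \sum_(i <- s) rnorm (F i).
Proof.
elim: s => [|i s IH]; first by rewrite !big_nil rnorm0.
by rewrite !big_cons (le_trans (rnormD _ _)) // lerD2l.
Qed.

Lemma rnorm_lt_eq0 x : (forall e, 0 < e -> rnorm x < e) -> x = 0.
Proof.
move=> h; apply: rnorm0_eq0; apply/eqP; rewrite eq_le rnorm_ge0 andbT.
by rewrite leNgt; apply/negP => /h; rewrite ltxx.
Qed.

Lemma cvg_rnormP (x : nat -> V) l :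
  (x @ \oo --> l) <->
  forall e, 0 < e -> exists N, forall n, (N <= n)%N -> rnorm (l - x n) < e.
Proof.
split.
  move/cvgrPdist_lt => h e e0.
  have e0' : 0 < e%:C by rewrite ltcR.
  have [N _ hN] := h _ e0'; exists N => n /hN.
  by rewrite /= normE ltcR.
move=> h; apply/cvgrPdist_lt => e e0.
have eE : e = (complex.Re e)%:C by rewrite RRe_real // gtr0_real.
have [|N hN] := h (complex.Re e); first by rewrite -ltcR -eE.
by exists N => // n /= /hN; rewrite -ltcR -eE -normE.
Qed.

End RealNorm.

Lemma rnorm_complete (R : realType) (V : completeNormedModType R[i]) (x : nat -> V) :
  (forall e, 0 < e -> exists N, forall n, (N <= n)%N -> rnorm (x N - x n) < e) ->
  exists l, forall e, 0 < e -> exists N, forall n, (N <= n)%N -> rnorm (l - x n) < e.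
Proof.
move=> h; suff /cvg_ex [l /cvg_rnormP hl] : cvg (x @ \oo) by exists l.
apply/cauchy_cvgP/cauchyP => e e0.
have eE : e = (complex.Re e)%:C by rewrite RRe_real // gtr0_real.
have [|N hN] := h (complex.Re e); first by rewrite -ltcR -eE.
exists (x N), N => // n /= /hN.
by rewrite -ball_normE /= -ltcR -eE -normE.
Qed.

Section BoundedSums.
Variables (R : realType) (I : eqType).
Implicit Types (x y : I -> R) (C D e : R).

(** A bound for the sum of a nonnegative family over [I], expressed by finite sums so that only real
    numbers occur. *)
Definition sums_le x C := forall s : seq I, uniq s -> \sum_(i <- s) x i <= C.

Lemma sums_le_ge0 x C : sums_le x C -> 0 <= C.
Proof. by move=> /(_ [::] isT); rewrite big_nil. Qed.

Lemma sums_leS x y C : (forall i, x i <= y i) -> sums_le y C -> sums_le x C.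
Proof. by move=> xy h s us; apply: le_trans (h _ us); apply: ler_sum. Qed.

Lemma sums_leW x C D : C <= D -> sums_le x C -> sums_le x D.
Proof. by move=> CD h s us; apply: le_trans (h _ us) CD. Qed.

Lemma sums_leD x y C D : sums_le x C -> sums_le y D ->
  sums_le (fun i => x i + y i) (C + D).
Proof. by move=> hx hy s us; rewrite big_split lerD ?hx ?hy. Qed.

Lemma sums_leM x C c : 0 <= c -> sums_le x C -> sums_le (fun i => c * x i) (c * C).
Proof. by move=> c0 h s us; rewrite -mulr_sumr ler_wpM2l ?h. Qed.

Lemma sums_le_inj (J : eqType) (g : J -> I) x C : injective g -> sums_le x C ->
  forall s, uniq s -> \sum_(j <- s) x (g j) <= C.
Proof.
move=> gi h s us; rewrite -(big_map g xpredT x).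
by apply: h; rewrite map_inj_uniq.
Qed.

Lemma sums_le1 x C i : sums_le x C -> x i <= C.
Proof. by move=> /(_ [:: i] isT); rewrite big_seq1. Qed.

(** Choose [s0] with a sum within [e] of the supremum; a disjoint finite set can add no more than
    [e]. *)
Lemma sums_le_tail x C : sums_le x C ->
  forall e, 0 < e -> exists2 s0, uniq s0 &
    forall t, uniq t -> {in t, forall i, i \notin s0} -> \sum_(i <- t) x i <= e.
Proof.
move=> h e e0; pose E := [set r | exists2 s, uniq s & r = \sum_(i <- s) x i].
have hE : has_sup E.
  split; first by exists 0, [::]; rewrite ?big_nil.
  by exists C => _ [s us ->]; exact: h.
have [_ [s0 us ->] hs] := sup_adherent e0 hE.
exists s0 => // t ut dt.
have : \sum_(i <- s0 ++ t) x i <= sup E.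
  apply: ub_le_sup; first exact: hE.2.
  exists (s0 ++ t) => //; rewrite cat_uniq us ut andbT /=.
  by apply/hasPn => i /dt.
by rewrite big_cat /=; lra.
Qed.

End BoundedSums.

Section UnconditionalSums.
Variables (R : realType) (V : normedModType R[i]).
Implicit Types (s l : V) (e C : R).

(** Unconditional convergence: the net of all finite partial sums tends to [l]. Invariance under
    bijections, needed for the shifts in the Cauchy product, is then immediate. *)
Definition hsum (I : eqType) (a : I -> V) l := forall e, 0 < e ->
  exists s0 : seq I, forall t, uniq t -> {subset s0 <= t} ->
    rnorm (l - \sum_(i <- t) a i) < e.

Variable I : eqType.
Implicit Types a b : I -> V.

Lemma hsumD a b k l : hsum a k -> hsum b l -> hsum (fun i => a i + b i) (k + l).
Proof.
move=> ha hb e e0; have e2 : 0 < e / 2 by rewrite divr_gt0.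
have [s hs] := ha _ e2; have [t ht] := hb _ e2.
exists (s ++ t) => r ur hr; rewrite big_split opprD addrACA.
apply: le_lt_trans (rnormD _ _) _; rewrite [e]splitr ltrD //.
  by apply: hs => // i hi; apply: hr; rewrite mem_cat hi.
by apply: ht => // i hi; apply: hr; rewrite mem_cat hi orbT.
Qed.

Lemma eq_hsum a b l : a =1 b -> hsum a l -> hsum b l.
Proof. by move=> /funext ->. Qed.

Lemma hsum_bij (J : eqType) (g : J -> I) (h : I -> J) a l :
  cancel g h -> cancel h g -> hsum a l -> hsum (a \o g) l.
Proof.
move=> gh hg ha e /ha [s hs]; exists (map h s) => t ut st.
rewrite -(big_map g xpredT a) /=; apply: hs.
  by rewrite map_inj_uniq //; exact: can_inj gh.
move=> i hi; rewrite -(hg i); apply: map_f; apply: st; exact: map_f.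
Qed.

Lemma hsum_rnorm_le a l C : hsum a l -> sums_le (fun i => rnorm (a i)) C ->
  rnorm l <= C.
Proof.
move=> ha hC; apply/ler_addgt0Pr => e /ha [s hs].
have hu : {subset s <= undup s} by move=> i; rewrite mem_undup.
have := hs _ (undup_uniq _) hu.
set S := \sum_(i <- _) _ => h.
have -> : l = (l - S) + S by rewrite subrK.
apply: le_trans (rnormD _ _) _; rewrite addrC lerD //; last exact: ltW.
by apply: le_trans (rnorm_sum _ _) _; apply: hC; exact: undup_uniq.
Qed.

Lemma hsum_finite a (s : seq I) : uniq s -> (forall i, i \notin s -> a i = 0) ->
  hsum a (\sum_(i <- s) a i).
Proof.
move=> us h e e0; exists s => t ut st.
suff -> : \sum_(i <- t) a i = \sum_(i <- s) a i by rewrite subrr rnorm0.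
rewrite (bigID (mem s)) /= [X in _ + X]big1 ?addr0; last by move=> i /h.
rewrite -big_filter; apply: perm_big; apply: uniq_perm => //.
  exact: filter_uniq.
by move=> i; rewrite mem_filter; case: (boolP (i \in s)) => //= /st ->.
Qed.

End UnconditionalSums.

Lemma hsum_map (R : realType) (V W : normedModType R[i]) (I : eqType) (f : V -> W)
    (C : R) (a : I -> V) l :
  {morph f : x y / x - y} -> (forall x, rnorm (f x) <= C * rnorm x) ->
  hsum a l -> hsum (f \o a) (f l).
Proof.
move=> fB fC ha e e0.
have f0 : f 0 = 0 by rewrite -(subrr 0) fB subrr.
have fD : {morph f : x y / x + y}.
  by move=> x y; rewrite -[y in LHS]opprK -(sub0r y) fB fB f0 sub0r opprK.
have C1 : 0 < `|C| + 1 by rewrite ltr_wpDl.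
have [s hs] := ha (e / (`|C| + 1)) (divr_gt0 e0 C1).
exists s => t ut st; rewrite -(big_morph f fD f0) -fB.
apply: le_lt_trans (fC _) _; have := hs _ ut st.
rewrite ltr_pdivlMr // => h; apply: le_lt_trans h.
rewrite mulrC ler_wpM2l ?rnorm_ge0 //; have := ler_norm C; lra.
Qed.

Section SumsOverZ.
Variable R : realType.

(** Enumerates -N, ..., N with the indexing of [fourier_partial_sum]. *)
Definition int_range (N : nat) : seq int :=
  [seq k%:Z - N%:Z | k <- iota 0 N.*2.+1].

Lemma int_range_uniq N : uniq (int_range N).
Proof. by rewrite map_inj_uniq ?iota_uniq // => i j; lia. Qed.

Lemma mem_int_range N n : (n \in int_range N) = (`|n| <= N)%N.
Proof.
apply/mapP/idP => [[k]|h]; first by rewrite mem_iota => h ->; lia.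
exists `|(n + N%:Z)%R|%N; last lia.
by rewrite mem_iota; lia.
Qed.

Lemma int_range_sub (s : seq int) :
  exists N, forall M, (N <= M)%N -> {subset s <= int_range M}.
Proof.
elim: s => [|n s [N hN]]; first by exists 0%N.
exists (maxn N `|n|%N) => M; rewrite geq_max => /andP[NM nM] i.
by rewrite inE => /orP[/eqP ->|]; [rewrite mem_int_range|exact: hN].
Qed.

Lemma big_int_range (T : Type) (idx : T) (op : Monoid.com_law idx) (F : int -> T) N :
  \big[op/idx]_(n <- int_range N) F n =
  \big[op/idx]_(k < N.*2.+1) F (k%:Z - N%:Z).
Proof. by rewrite big_map -[iota _ _]/(index_iota 0 N.*2.+1) big_mkord. Qed.

Lemma hsum_partial (V : normedModType R[i]) (a : int -> V) l : hsum a l ->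
  (fun N : nat => \sum_(n <- int_range N) a n) @ \oo --> l.
Proof.
move=> h; apply/cvg_rnormP => e /h [s hs].
have [N hN] := int_range_sub s; exists N => n /hN sn.
by apply: hs => //; exact: int_range_uniq.
Qed.

(** For large N the sum over [int_range N] is close to that over every larger finite set. These sums
    thus form a Cauchy sequence, and its limit is the limit of the whole net. *)
Lemma hsum_exists (V : completeNormedModType R[i]) (a : int -> V) C :
  sums_le (fun n => rnorm (a n)) C -> exists l, hsum a l.
Proof.
move=> h; have htail := sums_le_tail h.
have split_sum (s t : seq int) : uniq s -> {subset s <= t} -> uniq t ->
    \sum_(i <- t) a i = \sum_(i <- s) a i + \sum_(i <- t | i \notin s) a i.
  move=> us st ut; rewrite (bigID (mem s)) /=; congr (_ + _).
  rewrite -big_filter; apply: perm_big; apply: uniq_perm => //.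
    exact: filter_uniq.
  by move=> i; rewrite mem_filter; case: (boolP (i \in s)) => //= /st ->.
have close e : 0 < e -> exists N, forall t, uniq t ->
    {subset int_range N <= t} ->
    rnorm (\sum_(n <- int_range N) a n - \sum_(n <- t) a n) < e.
  move=> e0; have [s0 us0 hs0] := htail (e / 2) (divr_gt0 e0 (ltr0Sn _ 1)).
  have [N hN] := int_range_sub s0; exists N => t ut Nt.
  rewrite (split_sum _ _ (int_range_uniq N) Nt ut) opprD addrA subrr sub0r rnormN.
  apply: (@le_lt_trans _ _ (e / 2)); last lra.
  rewrite -big_filter; apply: le_trans (rnorm_sum _ _) _.
  apply: hs0 => [|i]; first exact: filter_uniq.
  rewrite mem_filter => /andP[hi _]; apply: contra hi; exact: hN.
have hx : forall e, 0 < e -> exists N, forall n, (N <= n)%N ->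
    rnorm (\sum_(i <- int_range N) a i - \sum_(i <- int_range n) a i) < e.
  move=> e /close [N hN]; exists N => n Nn; apply: hN; first exact: int_range_uniq.
  by move=> i; rewrite !mem_int_range => /leq_trans; exact.
have [l hl] := rnorm_complete hx; exists l => e e0.
have e3 : 0 < e / 3 by rewrite divr_gt0.
have [N hN] := close _ e3; have [M hM] := hl _ e3.
exists (int_range N) => t ut st.
pose K := maxn N M.
have h1 := hN _ ut st.
have h2 : rnorm (\sum_(n <- int_range N) a n - \sum_(n <- int_range K) a n) < e / 3.
  apply: hN; first exact: int_range_uniq.
  by move=> i; rewrite !mem_int_range => /leq_trans; apply; exact: leq_maxl.
have h3 := hM K (leq_maxr _ _).
set S := \sum_(n <- int_range N) _ in h1 h2; set SK := \sum_(n <- int_range K) _ in h2 h3.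
set St := \sum_(i <- t) _ in h1 *.
have -> : l - St = (l - SK) + ((SK - S) + (S - St)) by rewrite !addrA !subrK.
apply: le_lt_trans (rnormD _ _) _.
have := rnormD (SK - S) (S - St); rewrite (rdistC SK); lra.
Qed.

End SumsOverZ.

(** * Weighted l^p spaces *)

Section Powers.
Variables (R : realType) (p q : R).
Hypotheses (p_gt1 : 1 < p) (pq : p^-1 + q^-1 = 1).

Lemma conj_exponent_gt1 : 1 < q.
Proof.
have p0 : 0 < p by exact: lt_trans ltr01 p_gt1.
have h0 : 0 < p^-1 by rewrite invr_gt0.
have h1 : p^-1 < 1 by rewrite invf_lt1.
have q0 : 0 < q by rewrite -invr_gt0; move: pq; lra.
by rewrite -(invf_lt1 q0); move: pq; lra.
Qed.

Lemma powR_root_le (a b : R) : 0 <= a -> 0 <= b -> (a `^ (p^-1) <= b) = (a <= b `^ p).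
Proof.
have p0 : 0 < p by exact: lt_trans ltr01 p_gt1.
have pn0 : p != 0 by rewrite gt_eqF.
move=> a0 b0; have aE : (a `^ (p^-1)) `^ p = a by rewrite -powRrM mulVf // powRr1.
have bE : (b `^ p) `^ (p^-1) = b by rewrite -powRrM mulfV // powRr1.
apply/idP/idP => h.
  by rewrite -aE ge0_ler_powR ?nnegrE ?powR_ge0 // ltW.
by rewrite -bE ge0_ler_powR ?nnegrE ?powR_ge0 ?invr_ge0 // ltW.
Qed.

(** Hoelder's inequality with a normalised second factor: divide [t] by its p-norm and sum Young's
    inequality. *)
Lemma hoelder_sum (I : Type) (s : seq I) (t v : I -> R) :
  (forall i, 0 <= t i) -> (forall i, 0 <= v i) ->
  \sum_(i <- s) v i `^ q <= 1 ->
  (\sum_(i <- s) t i * v i) `^ p <= \sum_(i <- s) t i `^ p.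
Proof.
move=> t0 v0 hv; have q1 := conj_exponent_gt1.
have p0 : 0 < p by exact: lt_trans ltr01 p_gt1.
have q0 : 0 < q by lra.
set S := \sum_(i <- s) t i `^ p.
have S0 : 0 <= S by apply: sumr_ge0 => i _; exact: powR_ge0.
have T0 : 0 <= \sum_(i <- s) t i * v i by apply: sumr_ge0 => i _; exact: mulr_ge0.
rewrite -[leRHS]powRr1 // -(mulVf (lt0r_neq0 p0)) powRrM.
apply: ge0_ler_powR; rewrite ?nnegrE ?powR_ge0 ?(ltW p0) //; apply/ler_addgt0Pr => e e0.
(* Slightly more than the p-norm of [t], so that division is possible even if [t] vanishes. *)
set c := _ + e; have c0 : 0 < c by rewrite ltr_wpDl ?powR_ge0.
have Sc : S <= c `^ p by rewrite -powR_root_le ?(ltW c0) // /c lerDl ltW.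
have {}Sc : \sum_(i <- s) (t i / c) `^ p <= 1.
  rewrite (eq_bigr (fun i => t i `^ p * (c `^ p)^-1)) => [|i _]; last first.
    by rewrite powRM ?invr_ge0 ?(ltW c0) // -(powR_inv1 (ltW c0)) powRAC powR_inv1 ?powR_ge0.
  by rewrite -mulr_suml ler_pdivrMr ?mul1r ?powR_gt0.
suff : \sum_(i <- s) t i / c * v i <= 1.
  rewrite (eq_bigr (fun i => t i * v i / c)) => [|i _]; last by rewrite mulrAC.
  by rewrite -mulr_suml ler_pdivrMr // mul1r.
apply: le_trans (_ : \sum_(i <- s) ((t i / c) `^ p / p + v i `^ q / q) <= 1).
  apply: ler_sum => i _; apply: conjugate_powR => //.
  by rewrite divr_ge0 // ltW.
rewrite big_split -!mulr_suml /=.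
have hp : (\sum_(i <- s) (t i / c) `^ p) / p <= p^-1.
  by rewrite ler_pdivrMr // mulVf ?gt_eqF.
have hq : (\sum_(i <- s) v i `^ q) / q <= q^-1.
  by rewrite ler_pdivrMr // mulVf ?gt_eqF.
move: pq; lra.
Qed.

Lemma powR_convex (t x y : R) : 0 <= t -> t <= 1 -> 0 <= x -> 0 <= y ->
  (t * x + (1 - t) * y) `^ p <= t * x `^ p + (1 - t) * y `^ p.
Proof.
move=> t0 t1 x0 y0; have := @convex_powR R p (ltW p_gt1) (Itv01 t0 t1) x y.
by rewrite !inE /= !in_itv /= !andbT !convRE => /(_ x0 y0); exact.
Qed.

End Powers.

Section WeightedLp.
Variables (R : realType) (p q : R).
Hypotheses (p_gt1 : 1 < p) (pq : p^-1 + q^-1 = 1).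
Variables (w : int -> R).
Hypothesis w_ge1 : forall n, 1 <= w n.
Hypothesis w_conv : forall n (s : seq int), uniq s ->
  \sum_(k <- s) w k `^ (- q) * w (n - k) `^ (- q) <= w n `^ (- q).
Implicit Types (x y : int -> R) (c d : R).

Let p0 : 0 < p. Proof. exact: lt_trans ltr01 p_gt1. Qed.
Let w0 n : 0 < w n. Proof. exact: lt_le_trans ltr01 (w_ge1 n). Qed.

(** The norm of [x] in l^p(w) is at most [c], with both sides raised to the power p; [powR] carries
    no information for negative bases, hence the sign condition. *)
Definition lp_le x c :=
  0 <= c /\ sums_le (fun n => x n `^ p * w n `^ p) (c `^ p).

Lemma lp_leE (a : R) n : 0 <= a -> a `^ p * w n `^ p = (a * w n) `^ p.
Proof. by move=> x0; rewrite powRM // ltW. Qed.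

Lemma lp_leS x y c : (forall n, 0 <= x n <= y n) -> lp_le y c -> lp_le x c.
Proof.
move=> xy [c0 h]; split => //; apply: sums_leS h => n.
have /andP[x0 le_xy] := xy n.
rewrite ler_wpM2r ?powR_ge0 //; apply: ge0_ler_powR; rewrite ?nnegrE ?(ltW p0) //.
exact: le_trans le_xy.
Qed.

Lemma lp_leW x c d : c <= d -> lp_le x c -> lp_le x d.
Proof.
move=> cd [c0 h]; have d0 := le_trans c0 cd.
split => //; apply: sums_leW h.
by apply: ge0_ler_powR; rewrite ?nnegrE ?(ltW p0).
Qed.

Lemma lp_le_pt x c n : 0 <= x n -> lp_le x c -> x n <= c.
Proof.
move=> x0 [c0 /sums_le1 - /(_ n)]; rewrite lp_leE // => h.
have : x n * w n <= c.
  have := h; rewrite -(powR_root_le p_gt1) ?powR_ge0 //.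
  by rewrite -powRrM mulfV ?gt_eqF // powRr1 // mulr_ge0 // ltW.
by apply: le_trans; rewrite ler_peMr.
Qed.

Lemma lp_leZ x c k : (forall n, 0 <= x n) -> 0 <= k -> lp_le x c ->
  lp_le (fun n => k * x n) (k * c).
Proof.
move=> x0 k0 [c0 h]; split; first exact: mulr_ge0.
rewrite powRM //; apply: sums_leS (sums_leM (powR_ge0 k p) h) => n.
by rewrite powRM // mulrA.
Qed.

(** Minkowski's inequality, from convexity of the p-th power: x + y is c + d times the convex
    combination of x / c and y / d with weights c / (c + d) and d / (c + d). *)
Lemma lp_leD x y c d : (forall n, 0 <= x n) -> (forall n, 0 <= y n) ->
  lp_le x c -> lp_le y d -> lp_le (fun n => x n + y n) (c + d).
Proof.
move=> x0 y0 hx hy; have [c0 _] := hx; have [d0 _] := hy.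
have [c_eq0|c_neq0] := eqVneq c 0.
  apply: (lp_leW (_ : d <= c + d)); first by rewrite lerDr.
  apply: lp_leS hy => n; rewrite addr_ge0 //= gerDr.
  by rewrite -c_eq0; exact: lp_le_pt hx.
have [d_eq0|d_neq0] := eqVneq d 0.
  apply: (lp_leW (_ : c <= c + d)); first by rewrite lerDl.
  apply: lp_leS hx => n; rewrite addr_ge0 //= gerDl.
  by rewrite -d_eq0; exact: lp_le_pt hy.
have {c_neq0}c0' : 0 < c by rewrite lt_neqAle eq_sym c_neq0.
have {d_neq0}d0' : 0 < d by rewrite lt_neqAle eq_sym d_neq0.
have cd0 : 0 < c + d by rewrite addr_gt0.
split; first exact: ltW.
set t := c / (c + d).
have t1 : 1 - t = d / (c + d) by rewrite /t; field; rewrite gt_eqF.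
have t0 : 0 <= t by rewrite divr_ge0 // ltW.
have t0' : 0 <= 1 - t by rewrite t1 divr_ge0 // ltW.
have ci0 : 0 <= c^-1 by rewrite invr_ge0.
have di0 : 0 <= d^-1 by rewrite invr_ge0.
have [_ h1] := lp_leZ x0 ci0 hx.
have [_ h2] := lp_leZ y0 di0 hy.
rewrite mulVf ?gt_eqF // powR1 in h1; rewrite mulVf ?gt_eqF // powR1 in h2.
have := sums_leM (powR_ge0 (c + d) p) (sums_leD (sums_leM t0 h1) (sums_leM t0' h2)).
rewrite !mulr1 subrKC mulr1; apply: sums_leS => n.
rewrite !mulrA -!mulrDl mulrA ler_wpM2r ?powR_ge0 //.
have -> : x n + y n = (c + d) * (t * (c^-1 * x n) + (1 - t) * (d^-1 * y n)).
  by rewrite t1 /t; field; rewrite !gt_eqF.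
rewrite powRM ?(ltW cd0) //; last first.
  by rewrite addr_ge0 // mulr_ge0 // mulr_ge0 // invr_ge0 ltW.
rewrite ler_wpM2l ?powR_ge0 //; apply: powR_convex => //.
- by rewrite -subr_ge0.
- by rewrite mulr_ge0 // invr_ge0 ltW.
- by rewrite mulr_ge0 // invr_ge0 ltW.
Qed.

(** After scaling [c] to 1, Young's inequality is applied to the product of x w and w^-1. *)
Lemma lp_le_l1 W x c : sums_le (fun n => w n `^ (- q)) W -> (forall n, 0 <= x n) ->
  lp_le x c -> sums_le x (c * (1 + W)).
Proof.
move=> hW x0 hx; have q1 := conj_exponent_gt1 p_gt1 pq.
have q0 : 0 < q by exact: lt_trans ltr01 q1.
have [c0 _] := hx; have W0 := sums_le_ge0 hW.
have [c_eq0|c_neq0] := eqVneq c 0.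
  move=> s us; rewrite big1 ?c_eq0 ?mul0r // => n _.
  by apply/eqP; rewrite eq_le x0 andbT -c_eq0; exact: lp_le_pt hx.
have {c_neq0}c0' : 0 < c by rewrite lt_neqAle eq_sym c_neq0.
have ci0 : 0 <= c^-1 by rewrite invr_ge0.
have [_ h1] := lp_leZ x0 ci0 hx; rewrite mulVf ?gt_eqF // powR1 in h1.
have h : sums_le (fun n => c^-1 * x n) (1 + W).
  apply: sums_leS (sums_leD h1 hW) => n.
  have cx0 : 0 <= c^-1 * x n by exact: mulr_ge0.
  rewrite lp_leE //.
  have -> : c^-1 * x n = (c^-1 * x n * w n) * (w n)^-1 by rewrite mulfK // gt_eqF.
  apply: le_trans (conjugate_powR _ _ p0 q0 pq) _.
  - by rewrite mulr_ge0 // ltW.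
  - by rewrite invr_ge0 ltW.
  rewrite mulfVK ?gt_eqF // -(powR_inv1 (ltW (w0 n))) -powRrM mulN1r.
  apply: lerD; rewrite ler_piMr ?powR_ge0 // invf_le1 //; exact: ltW.
have := sums_leM c0 h; apply: sums_leS => n.
by rewrite mulrA mulfV ?gt_eqF // mul1r.
Qed.

(** The q-th powers of w(n) / (w(k) w(n - k)) sum to at most 1 over k, by [w_conv]. Hoelder's
    inequality with these factors bounds the p-th power of the weighted convolution by the
    convolution of the p-th powers, which is then summed over n. *)
Lemma lp_le_conv x y c d (K : seq int) : (forall n, 0 <= x n) -> (forall n, 0 <= y n) ->
  uniq K -> lp_le x c -> lp_le y d ->
  lp_le (fun n => \sum_(k <- K) x k * y (n - k)) (c * d).
Proof.
move=> x0 y0 uK [c0 hx] [d0 hy]; split; first exact: mulr_ge0.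
have xy0 n : 0 <= \sum_(k <- K) x k * y (n - k).
  by apply: sumr_ge0 => k _; exact: mulr_ge0.
have w0' n : 0 <= w n by exact: ltW.
pose t n k := (x k * w k) * (y (n - k) * w (n - k)).
have pt n : (\sum_(k <- K) x k * y (n - k)) `^ p * w n `^ p <=
    \sum_(k <- K) (x k `^ p * w k `^ p) * (y (n - k) `^ p * w (n - k) `^ p).
  rewrite lp_leE // mulr_suml.
  have -> : \sum_(k <- K) x k * y (n - k) * w n =
      \sum_(k <- K) t n k * (w n * ((w k)^-1 * (w (n - k))^-1)).
    apply: eq_bigr => k _; rewrite /t; field; by rewrite !gt_eqF.
  have -> : \sum_(k <- K) (x k `^ p * w k `^ p) * (y (n - k) `^ p * w (n - k) `^ p) =
      \sum_(k <- K) t n k `^ p.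
    apply: eq_bigr => k _; rewrite !lp_leE // -powRM // mulr_ge0 //.
  apply: (hoelder_sum p_gt1 pq) => [k|k|].
  - by rewrite !mulr_ge0.
  - by rewrite !mulr_ge0 // invr_ge0.
  have -> : \sum_(k <- K) (w n * ((w k)^-1 * (w (n - k))^-1)) `^ q =
      w n `^ q * \sum_(k <- K) w k `^ (- q) * w (n - k) `^ (- q).
    rewrite mulr_sumr; apply: eq_bigr => k _.
    rewrite powRM ?mulr_ge0 ?invr_ge0 // powRM ?invr_ge0 //.
    by rewrite -(powR_inv1 (w0' k)) -(powR_inv1 (w0' (n - k))) -!powRrM !mulN1r.
  apply: le_trans (ler_wpM2l (powR_ge0 _ _) (w_conv n uK)) _.
  by rewrite powRN mulfV // gt_eqF // powR_gt0.
move=> s us; apply: le_trans (ler_sum _ (fun n _ => pt n)) _.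
rewrite exchange_big /= powRM //.
apply: (@le_trans _ _ (\sum_(k <- K) x k `^ p * w k `^ p * d `^ p)).
  apply: ler_sum => k _; rewrite -mulr_sumr ler_wpM2l ?mulr_ge0 ?powR_ge0 //.
  have inj : injective (fun n : int => n - k) by move=> i j /addIr.
  exact: (sums_le_inj inj hy us).
by rewrite -mulr_suml ler_wpM2r ?powR_ge0 // hx.
Qed.

(** A form of Fatou's lemma: a finite sum involves finitely many indices, where [x] exceeds some
    [X N] by little, and Minkowski's inequality controls the excess. *)
Lemma lp_le_lim (x : int -> R) (X : nat -> int -> R) c :
  (forall n, 0 <= x n) -> (forall N n, 0 <= X N n) ->
  (forall n e, 0 < e -> exists N0, forall N, (N0 <= N)%N -> x n <= X N n + e) ->
  (forall N, lp_le (X N) c) -> lp_le x c.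
Proof.
move=> x0 X0 hX hc; have [c0 _] := hc 0%N; split => // s us.
(* The norm of the indicator of [s] in l^p(w). *)
pose Ws := (\sum_(n <- s) w n `^ p) `^ p^-1.
have Ws0 : 0 <= Ws by exact: powR_ge0.
have S0 : 0 <= \sum_(n <- s) x n `^ p * w n `^ p.
  by apply: sumr_ge0 => n _; rewrite mulr_ge0 ?powR_ge0.
have hW : lp_le (fun n => (n \in s)%:R) Ws.
  split => // t ut.
  rewrite /Ws -powRrM mulVf ?gt_eqF // powRr1; last by apply: sumr_ge0 => n _; exact: powR_ge0.
  rewrite (bigID (mem s)) /= [X in _ + X]big1 ?addr0; last first.
    by move=> n /negbTE ->; rewrite powR0 ?gt_eqF // mul0r.
  rewrite (eq_bigr (fun n => w n `^ p)); last by move=> n ->; rewrite powR1 mul1r.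
  rewrite [leRHS](bigID (mem t)) /= -big_filter -[X in _ <= X + _]big_filter.
  rewrite (perm_big [seq n <- s | n \in t]).
    by rewrite lerDl; apply: sumr_ge0 => n _; exact: powR_ge0.
  by apply: uniq_perm; rewrite ?filter_uniq // => n; rewrite !mem_filter andbC.
have eps e : 0 < e -> exists N, {in s, forall n, x n <= X N n + e}.
  move=> e0; suff [N0 hN] : exists N0, forall N, (N0 <= N)%N -> {in s, forall n, x n <= X N n + e}.
    by exists N0; exact: hN.
  elim: s {us Ws Ws0 S0 hW} => [|n s [N0 hN]]; first by exists 0%N.
  have [N1 hN1] := hX n e e0.
  exists (maxn N0 N1) => N; rewrite geq_max => /andP[h0 h1] m.
  by rewrite inE => /orP[/eqP ->|hm]; [exact: hN1|exact: hN].
rewrite -(powR_root_le p_gt1) //; apply/ler_addgt0Pr => e e0.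
have e0' : 0 < e / (Ws + 1) by rewrite divr_gt0 // ltr_wpDl.
have [N hN] := eps _ e0'.
have [_ h] := lp_leD (X0 N) (fun n => mulr_ge0 (ltW e0') (ler0n _ (n \in s))) (hc N)
  (lp_leZ (fun n => ler0n R (n \in s)) (ltW e0') hW).
apply: le_trans (_ : c + e / (Ws + 1) * Ws <= _); last first.
  by rewrite lerD2l mulrAC ler_pdivrMr ?ltr_wpDl // ler_pM2l // lerDl.
rewrite powR_root_le //; last by rewrite addr_ge0 // mulr_ge0 // ltW.
apply: le_trans (h s us); rewrite big_seq [leRHS]big_seq; apply: ler_sum => n sn.
rewrite sn mulr1 ler_wpM2r ?powR_ge0 //; apply: ge0_ler_powR; rewrite ?nnegrE ?(ltW p0) //.
- by rewrite addr_ge0 // ltW.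
- exact: hN.
Qed.

Lemma lp_le_tail x c : lp_le x c -> forall e, 0 < e ->
  exists2 s0 : seq int, uniq s0 & lp_le (fun n => if n \in s0 then 0 else x n) e.
Proof.
move=> [c0 h] e e0; have [s0 us0 hs] := sums_le_tail h (powR_gt0 p e0).
exists s0 => //; split => [|t ut]; first exact: ltW.
rewrite (bigID (mem s0)) /= big1 ?add0r; last first.
  by move=> n ->; rewrite powR0 ?gt_eqF // mul0r.
rewrite (eq_bigr (fun n => x n `^ p * w n `^ p)); last by move=> n /negbTE ->.
rewrite -big_filter; apply: hs => [|n]; first exact: filter_uniq.
by rewrite mem_filter => /andP[].
Qed.

End WeightedLp.

(** * The algebra of p-th power weighted absolutely convergent series *)

Section CauchyProduct.
Variables (R : realType) (A : banachAlgebra R).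
Implicit Types (a b : int -> A) (x y : A).

Lemma rnormM x y : rnorm (x * y) <= rnorm x * rnorm y.
Proof. by rewrite -lecR rmorphM /= -!normE banach_normM. Qed.

Lemma hsum_sum (V : normedModType R[i]) (I : eqType) (J : Type) (s : seq J)
    (F : J -> I -> V) (l : J -> V) :
  (forall j, hsum (F j) (l j)) ->
  hsum (fun i => \sum_(j <- s) F j i) (\sum_(j <- s) l j).
Proof.
move=> h; elim: s => [|j s IH].
  rewrite big_nil; apply: (@eq_hsum _ _ _ (fun=> 0)); first by move=> i; rewrite big_nil.
  by have := @hsum_finite R V I (fun=> 0) [::] isT (fun _ _ => erefl); rewrite big_nil.
rewrite big_cons; apply: (@eq_hsum _ _ _ (fun i => F j i + \sum_(j <- s) F j i)).
  by move=> i; rewrite big_cons.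
exact: hsumD.
Qed.

Lemma hsumB (V : normedModType R[i]) (I : eqType) (a b : I -> V) k l :
  hsum a k -> hsum b l -> hsum (fun i => a i - b i) (k - l).
Proof.
move=> ha hb; apply: hsumD => //.
apply: (hsum_map (f := fun v : V => - v) (C := 1)) => //.
- by move=> u v; rewrite opprD.
- by move=> v; rewrite rnormN mul1r.
Qed.

Lemma hsumZ (V : normedModType R[i]) (I : eqType) (a : I -> V) l c :
  hsum a l -> hsum (fun i => c *: a i) (c *: l).
Proof.
apply: (hsum_map (f := fun v : V => c *: v) (C := nc c)).
- by move=> u v; rewrite scalerBr.
- by move=> v; rewrite rnormZ.
Qed.

Lemma hsum_convolution_exists a b C D :
  sums_le (fun n => rnorm (a n)) C -> sums_le (fun n => rnorm (b n)) D ->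
  exists c : int -> A, forall n, hsum (fun k => a k * b (n - k)) (c n).
Proof.
move=> ha hb.
suff /choice [c hc] : forall n, exists c, hsum (fun k => a k * b (n - k)) c by exists c.
move=> n.
have D0 := sums_le_ge0 hb.
apply: (@hsum_exists _ _ _ (D * C)); apply: sums_leS (sums_leM D0 ha) => k.
rewrite mulrC; apply: le_trans (rnormM _ _) _.
by rewrite ler_wpM2l ?rnorm_ge0 //; exact: sums_le1 hb.
Qed.

(** Split [a] into a finite part [a'] and a rest of l^1 norm at most [e1]. The convolution with [a']
    is a finite combination of shifts of [b] and sums to x' y; the rest contributes at most e1 D
    both to the product and to every finite sum of [c]. *)
Lemma hsum_cauchy_product a b c x y C D :
  sums_le (fun n => rnorm (a n)) C -> sums_le (fun n => rnorm (b n)) D ->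
  hsum a x -> hsum b y -> (forall n, hsum (fun k => a k * b (n - k)) (c n)) ->
  hsum c (x * y).
Proof.
move=> ha hb hx hy hc e e0; have D0 := sums_le_ge0 hb.
pose e1 := e / (3 * (D + 1)).
have e10 : 0 < e1 by rewrite divr_gt0 // mulr_gt0 // ltr_wpDl.
have e1E : e1 * D * 3 <= e.
  have : e1 * (3 * (D + 1)) = e by rewrite divfK // gt_eqF // mulr_gt0 // ltr_wpDl.
  lra.
have [s us hs] := sums_le_tail ha e10.
pose a' n := if n \in s then a n else 0.
pose r n := a n - a' n.
have rE n : r n = if n \in s then 0 else a n.
  by rewrite /r /a'; case: ifP => _; rewrite ?subrr ?subr0.
have a'0 n : n \notin s -> a' n = 0 by rewrite /a' => /negbTE ->.
have hr : sums_le (fun n => rnorm (r n)) e1.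
  move=> t ut; rewrite (bigID (mem s)) /= big1 ?add0r; last first.
    by move=> n ns; rewrite rE ns rnorm0.
  rewrite (eq_bigr (fun n => rnorm (a n))); last by move=> n /negbTE ns; rewrite rE ns.
  rewrite -big_filter; apply: hs => [|n]; first exact: filter_uniq.
  by rewrite mem_filter => /andP[].
set x' := \sum_(n <- s) a' n.
have hx' : hsum a' x' by exact: hsum_finite.
have hxx' : rnorm (x - x') <= e1 by apply: hsum_rnorm_le hr; exact: hsumB.
pose c' n := \sum_(k <- s) a' k * b (n - k).
have hc' n : hsum (fun k => a' k * b (n - k)) (c' n).
  by apply: hsum_finite => // k /a'0 ->; rewrite mul0r.
have hc'y : hsum c' (x' * y).
  rewrite /x' mulr_suml; apply: hsum_sum => k.
  have hbk : hsum (fun n => b (n - k)) y.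
    apply: (hsum_bij (g := fun n : int => n - k) (h := fun n => n + k)) hy.
      exact: subrK.
    exact: addrK.
  apply: (hsum_map (f := fun z : A => a' k * z) (C := rnorm (a' k))) hbk.
  - by move=> u v; rewrite mulrBr.
  - by move=> v; exact: rnormM.
have [s0 hs0] := hc'y (e / 3) (divr_gt0 e0 (ltr0Sn _ 2)).
exists s0 => t ut st; have {hs0} := hs0 _ ut st.
set T' := \sum_(i <- t) c' i; set T := \sum_(i <- t) c i => h1.
have h2 : rnorm (T - T') <= e1 * D.
  rewrite /T /T' -sumrB.
  have hd : hsum (fun k => r k * \sum_(n <- t) b (n - k)) (\sum_(n <- t) (c n - c' n)).
    apply: (@eq_hsum _ _ _ (fun k => \sum_(n <- t) r k * b (n - k))).
      by move=> k; rewrite mulr_sumr.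
    apply: hsum_sum => n.
    apply: (eq_hsum _ (hsumB (hc n) (hc' n))) => k; by rewrite -mulrBl.
  apply: hsum_rnorm_le hd _; rewrite mulrC; apply: sums_leS (sums_leM D0 hr) => k.
  rewrite mulrC; apply: le_trans (rnormM _ _) _.
  rewrite ler_wpM2l ?rnorm_ge0 //; apply: le_trans (rnorm_sum _ _) _.
  by apply: (sums_le_inj _ hb ut) => i j /addIr.
have h3 : rnorm ((x - x') * y) <= e1 * D.
  apply: le_trans (rnormM _ _) _; apply: ler_pM; rewrite ?rnorm_ge0 //.
  exact: hsum_rnorm_le hy hb.
have -> : x * y - T = ((x - x') * y + (x' * y - T')) - (T - T').
  rewrite mulrBl -[T - T']opprB opprK !addrA subrK.
  by rewrite subrK.
apply: le_lt_trans (rnormB _ _) _.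
have := rnormD ((x - x') * y) (x' * y - T'); lra.
Qed.

End CauchyProduct.

Section Geometric.
Variable R : realType.

Lemma expr_small (c e : R) : 0 <= c -> c < 1 -> 0 < e ->
  exists N, forall n, (N <= n)%N -> c ^+ n < e.
Proof.
move=> c0 c1 e0; have c1' : `|c| < 1 by rewrite ger0_norm.
have /cvgrPdist_lt/(_ _ e0) [N _ hN] := cvg_expr c1'.
exists N => n /hN /=; rewrite sub0r normrN ger0_norm //; exact: exprn_ge0.
Qed.

Lemma geometric_sum_le (c : R) j m : 0 <= c -> c < 1 ->
  \sum_(j <= k < j + m) c ^+ k <= c ^+ j / (1 - c).
Proof.
move=> c0 c1; have c1' : 0 < 1 - c by rewrite subr_gt0.
rewrite ler_pdivlMr // mulrC.
have -> : (1 - c) * \sum_(j <= k < j + m) c ^+ k = c ^+ j - c ^+ (j + m).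
  elim: m => [|m IH]; first by rewrite addn0 big_geq // mulr0 subrr.
  rewrite addnS big_nat_recr ?leq_addr //= mulrDr IH exprS; ring.
by rewrite gerBl exprn_ge0.
Qed.

End Geometric.

Section FourierAlgebra.
Variables (R : realType) (A : banachAlgebra R) (p q W : R) (w : int -> R).
Hypotheses (p_gt1 : 1 < p) (pq : p^-1 + q^-1 = 1).
Hypothesis w_ge1 : forall n, 1 <= w n.
Hypothesis w_conv : forall n (s : seq int), uniq s ->
  \sum_(k <- s) w k `^ (- q) * w (n - k) `^ (- q) <= w n `^ (- q).
Hypothesis w_sum : sums_le (fun n => w n `^ (- q)) W.

Local Notation T := (R[i]^o -> A).

(* Retracts the complex plane onto the circle, so that a function on the circle
   becomes a function on the whole plane. *)
Definition to_circle (z : R[i]) : R[i] := if `|z| == 1 then z else 1.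

Lemma normc_to_circle z : nc (to_circle z) = 1.
Proof.
rewrite /to_circle; case: eqP => [[h]|_]; last exact: Normc.normc1.
by [].
Qed.

Lemma to_circle_neq0 z : to_circle z != 0.
Proof.
by apply: contra_eq_neq (normc_to_circle z) => ->; rewrite Normc.normc0 eq_sym oner_neq0.
Qed.

Lemma normcX (z : R[i]) n : nc (z ^+ n) = nc z ^+ n.
Proof. by elim: n => [|n IH]; rewrite ?Normc.normc1 // !exprS Normc.normcM IH. Qed.

Lemma normc_to_circleX z n : nc (to_circle z ^ n) = 1.
Proof.
case: n => n; first by rewrite -exprnP normcX normc_to_circle expr1n.
by rewrite NegzE -exprnN Normc.normcV normcX normc_to_circle expr1n invr1.
Qed.

(** Imposed at every complex [z] through the retraction, so that [a] determines [F] everywhere and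
    equalities in [T] follow from equalities of series. *)
Definition fourier_expansion (F : T) (a : int -> A) :=
  forall z, hsum (fun n => to_circle z ^ n *: a n) (F z).

(** The norm of the Fourier algebra as a relation on all functions; those without an expansion in
    l^p(w) satisfy no bound. *)
Definition wiener_bound (F : T) (c : R) := exists2 a, fourier_expansion F a &
  lp_le p w (fun n => rnorm (a n)) c.

Lemma rnorm_to_circleZ z n (x : A) : rnorm (to_circle z ^ n *: x) = rnorm x.
Proof. by rewrite rnormZ normc_to_circleX mul1r. Qed.

Lemma coef_sums_le (a : int -> A) c : lp_le p w (fun n => rnorm (a n)) c ->
  sums_le (fun n => rnorm (a n)) (c * (1 + W)).
Proof. by apply: (lp_le_l1 p_gt1 pq w_ge1 w_sum) => n; exact: rnorm_ge0. Qed.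

Lemma term_sums_le (a : int -> A) c z : lp_le p w (fun n => rnorm (a n)) c ->
  sums_le (fun n => rnorm (to_circle z ^ n *: a n)) (c * (1 + W)).
Proof. by move=> /coef_sums_le; apply: sums_leS => n; rewrite rnorm_to_circleZ. Qed.

Lemma wiener_bound_sup F c z : wiener_bound F c -> rnorm (F z) <= c * (1 + W).
Proof. by move=> [a ha hc]; apply: hsum_rnorm_le (ha z) _; exact: term_sums_le. Qed.

Lemma expansion_exists (a : int -> A) c : lp_le p w (fun n => rnorm (a n)) c ->
  exists F, fourier_expansion F a.
Proof.
move=> h; suff /choice [F hF] : forall z : R[i]^o,
    exists l, hsum (fun n => to_circle z ^ n *: a n) l.
  by exists F.
by move=> z; exact: hsum_exists (term_sums_le z h).
Qed.

Lemma wiener_bound_ge0 F c : wiener_bound F c -> 0 <= c.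
Proof. by case=> a _ []. Qed.

Lemma wiener_bound_le F c d : c <= d -> wiener_bound F c -> wiener_bound F d.
Proof. by move=> cd [a ha hc]; exists a => //; exact: lp_leW hc. Qed.

Lemma lp_le_rnormD (a b : int -> A) c d :
  lp_le p w (fun n => rnorm (a n)) c -> lp_le p w (fun n => rnorm (b n)) d ->
  lp_le p w (fun n => rnorm (a n + b n)) (c + d).
Proof.
move=> ha hb.
have h := lp_leD p_gt1 w_ge1 (fun n => rnorm_ge0 (a n)) (fun n => rnorm_ge0 (b n)) ha hb.
by apply: (lp_leS p_gt1) h => n; rewrite rnorm_ge0 rnormD.
Qed.

Lemma wiener_boundD F G c d : wiener_bound F c -> wiener_bound G d ->
  wiener_bound (F + G) (c + d).
Proof.
move=> [a ha hc] [b hb hd]; exists (fun n => a n + b n); last exact: lp_le_rnormD.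
by move=> z; apply: (eq_hsum _ (hsumD (ha z) (hb z))) => n; rewrite scalerDr.
Qed.

Lemma wiener_boundN F c : wiener_bound F c -> wiener_bound (- F) c.
Proof.
move=> [a ha hc]; exists (fun n => - a n).
  move=> z; have := hsumZ (-1) (ha z); rewrite scaleN1r.
  by apply: eq_hsum => n; rewrite scaleN1r scalerN.
by apply: (lp_leS p_gt1) hc => n; rewrite rnorm_ge0 rnormN /=.
Qed.

(** The product has the convolution as coefficients, by the Cauchy product. Truncated convolutions
    obey the bound by [lp_le_conv], and it passes to the limit by [lp_le_lim]. *)
Lemma wiener_boundM F G c d : wiener_bound F c -> wiener_bound G d ->
  wiener_bound (F * G) (c * d).
Proof.
move=> [a ha hc] [b hb hd].
have [e he] := hsum_convolution_exists (coef_sums_le hc) (coef_sums_le hd).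
exists e.
  move=> z; apply: hsum_cauchy_product (ha z) (hb z) _.
  - exact: term_sums_le hc.
  - exact: term_sums_le hd.
  move=> n; apply: (eq_hsum _ (hsumZ (to_circle z ^ n) (he n))) => k.
  rewrite -scalerAl -scalerAr scalerA -expfzDr ?to_circle_neq0 //.
  by congr (_ ^ _ *: _); lia.
pose X (N : nat) n := \sum_(k <- int_range N) rnorm (a k) * rnorm (b (n - k)).
apply: (lp_le_lim p_gt1 w_ge1 (X := X)).
- by move=> n; exact: rnorm_ge0.
- by move=> N n; apply: sumr_ge0 => k _; rewrite mulr_ge0 ?rnorm_ge0.
- move=> n r r0; have [s hs] := he n _ r0; have [N hN] := int_range_sub s.
  exists N => M /hN sM; have := hs _ (int_range_uniq M) sM.
  set S := \sum_(k <- _) _ => h.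
  have hS : rnorm S <= X M n.
    apply: le_trans (rnorm_sum _ _) _; apply: ler_sum => k _; exact: rnormM.
  have -> : e n = (e n - S) + S by rewrite subrK.
  by apply: le_trans (rnormD _ _) _; lra.
move=> N; exact: (lp_le_conv p_gt1 pq w_ge1 w_conv (fun n => rnorm_ge0 (a n))
  (fun n => rnorm_ge0 (b n)) (int_range_uniq N) hc hd).
Qed.

Definition monomial (n : int) (x : A) : T := fun z => to_circle z ^ n *: x.

Lemma wiener_bound_monomial n x : wiener_bound (monomial n x) (rnorm x * w n).
Proof.
have w0 : 0 <= w n by exact: le_trans ler01 (w_ge1 n).
exists (fun k => if k == n then x else 0).
  move=> z.
  have h0 k : k \notin [:: n] -> to_circle z ^ k *: (if k == n then x else 0) = 0.
    by rewrite inE => /negbTE ->; rewrite scaler0.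
  have us1 : uniq [:: n] by [].
  by have := hsum_finite us1 h0; rewrite big_seq1 eqxx.
split=> [|s us]; first by rewrite mulr_ge0 ?rnorm_ge0.
rewrite powRM ?rnorm_ge0 //.
rewrite (bigID (pred1 n)) /= [X in _ + X]big1 ?addr0; last first.
  move=> k /negbTE ->; rewrite rnorm0 powR0 ?mul0r // gt_eqF //.
  exact: lt_trans ltr01 p_gt1.
rewrite (eq_bigr (fun k => rnorm x `^ p * w n `^ p)); last by move=> k /eqP ->; rewrite eqxx.
rewrite -big_filter; have [ns|ns] := boolP (n \in s).
  by rewrite filter_pred1_uniq // big_seq1.
rewrite big1_seq ?mulr_ge0 ?powR_ge0 // => k /andP[_].
by rewrite mem_filter => /andP[/eqP -> ]; rewrite (negbTE ns).
Qed.

Definition const_fun (z : R[i]) : T := fun _ => z%:A.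

Lemma wiener_bound_const z : wiener_bound (const_fun z) (rnorm (1 : A) * w 0 * nc z).
Proof.
have := wiener_bound_monomial 0 (z%:A); rewrite rnormZ.
have -> : monomial 0 z%:A = const_fun z.
  by apply/funext => t; rewrite /monomial expr0z scale1r.
by have -> : rnorm (1 : A) * w 0 * nc z = nc z * rnorm (1 : A) * w 0 by ring.
Qed.

Lemma lp_le_rnorm_sum (a : nat -> int -> A) (c : nat -> R) j m :
  (forall k, lp_le p w (fun n => rnorm (a k n)) (c k)) ->
  lp_le p w (fun n => rnorm (\sum_(j <= k < j + m) a k n)) (\sum_(j <= k < j + m) c k).
Proof.
move=> h; elim: m => [|m IH].
  rewrite addn0 big_geq //; split => // s us.
  rewrite big1 ?powR_ge0 // => n _.
  by rewrite big_geq // rnorm0 powR0 ?mul0r // gt_eqF // (lt_trans ltr01 p_gt1).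
rewrite addnS big_nat_recr ?leq_addr //=.
apply: (lp_leS p_gt1) (lp_le_rnormD IH (h (j + m)%N)) => n.
by rewrite rnorm_ge0 big_nat_recr ?leq_addr //=.
Qed.

Lemma wiener_bound_eq0 F : (forall e, 0 < e -> wiener_bound F e) -> F = 0.
Proof.
move=> h; apply/funext => z; apply: rnorm_lt_eq0 => e e0.
have W0 := sums_le_ge0 w_sum; have W1 : 0 < 2 * (1 + W) by rewrite mulr_gt0 // ltr_pwDl.
have := wiener_bound_sup z (h _ (divr_gt0 e0 W1)).
have : e / (2 * (1 + W)) * (2 * (1 + W)) = e by rewrite divfK // gt_eqF.
lra.
Qed.

Lemma fourier_expansion_sum (F : nat -> T) (a : nat -> int -> A) j :
  (forall k, fourier_expansion (F k) (a k)) ->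
  fourier_expansion (\sum_(0 <= k < j) F k) (fun n => \sum_(0 <= k < j) a k n).
Proof.
move=> h z; rewrite fct_sumE.
have := hsum_sum (index_iota 0 j) (fun k => h k z).
by apply: eq_hsum => n; rewrite scaler_sumr.
Qed.

Lemma wiener_bound1 : wiener_bound 1 (rnorm (1 : A) * w 0).
Proof.
have := wiener_bound_const 1; rewrite Normc.normc1 mulr1.
by have -> : const_fun 1 = 1 by apply/funext => z; rewrite /const_fun scale1r.
Qed.

(** The geometric series is summed coefficientwise in [A], and [lp_le_lim] carries the tail
    estimates over to the limit. The inverse identities hold because the difference of their sides
    has arbitrarily small bounds. *)
Lemma wiener_neumann F c : c < 1 -> wiener_bound F c ->
  exists G, [/\ wiener_bound G (rnorm (1 : A) * w 0 / (1 - c)),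
    G * (1 - F) = 1 & (1 - F) * G = 1].
Proof.
move=> c1 hF; have c0 := wiener_bound_ge0 hF.
have c1' : 0 < 1 - c by rewrite subr_gt0.
set M := _ * w 0; have M0 : 0 <= M := wiener_bound_ge0 wiener_bound1.
(* The factor [M] bounds the unit F^0. *)
have hX k : wiener_bound (F ^+ k) (M * c ^+ k).
  elim: k => [|k IH]; first by rewrite !expr0 mulr1; exact: wiener_bound1.
  by rewrite !exprS mulrCA; exact: wiener_boundM.
have /choice [a ha] : forall k, exists a, fourier_expansion (F ^+ k) a /\
    lp_le p w (fun n => rnorm (a n)) (M * c ^+ k).
  by move=> k; have [a h1 h2] := hX k; exists a.
have tail j m : lp_le p w (fun n => rnorm (\sum_(j <= k < j + m) a k n)) (M * (c ^+ j / (1 - c))).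
  apply: (lp_leW p_gt1) (lp_le_rnorm_sum j m (fun k => (ha k).2)).
  by rewrite -mulr_sumr ler_wpM2l // geometric_sum_le.
have small e : 0 < e -> exists j, M * (c ^+ j / (1 - c)) < e.
  move=> e0; have e1 : 0 < e * (1 - c) / (M + 1) by rewrite divr_gt0 ?mulr_gt0 // ltr_wpDl.
  have [N hN] := expr_small c0 c1 e1; exists N; have := hN _ (leqnn N).
  rewrite ltr_pdivlMr ?ltr_wpDl // mulrA ltr_pdivrMr //.
  apply: le_lt_trans; rewrite mulrC ler_wpM2l ?exprn_ge0 //; lra.
have sub j m n : \sum_(0 <= k < j + m) a k n - \sum_(0 <= k < j) a k n =
    \sum_(j <= k < j + m) a k n.
  by rewrite (@big_cat_nat _ _ _ j) ?leq_addr //= addrAC subrr add0r.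
have /choice [b hb] : forall n, exists l, forall e, 0 < e ->
    exists N, forall k, (N <= k)%N -> rnorm (l - \sum_(0 <= i < k) a i n) < e.
  move=> n; apply: rnorm_complete => e e0.
  have [N hN] := small _ e0; exists N => k Nk.
  rewrite rdistC -(subnKC Nk) sub; apply: le_lt_trans hN.
  exact: (lp_le_pt p_gt1 w_ge1 (rnorm_ge0 _) (tail N (k - N)%N)).
have hbj j : lp_le p w (fun n => rnorm (b n - \sum_(0 <= k < j) a k n)) (M * (c ^+ j / (1 - c))).
  apply: (lp_le_lim p_gt1 w_ge1 (X := fun m n => rnorm (\sum_(j <= k < j + m) a k n))).
  - by move=> n; exact: rnorm_ge0.
  - by move=> m n; exact: rnorm_ge0.
  - move=> n e /(hb n) [N hN]; exists N => m Nm.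
    have := hN (j + m)%N (leq_trans Nm (leq_addl _ _)).
    rewrite -sub; set S := \sum_(0 <= i < j + m) _; set S' := \sum_(0 <= i < j) _.
    have -> : b n - S' = (b n - S) + (S - S') by rewrite addrA subrK.
    move=> h; apply: le_trans (rnormD _ _) _; lra.
  exact: tail.
have hb0 : lp_le p w (fun n => rnorm (b n)) (M / (1 - c)).
  have := hbj 0%N; rewrite expr0 mul1r; apply: (lp_leS p_gt1) => n.
  by rewrite big_geq // subr0 rnorm_ge0 /=.
have [G hG] := expansion_exists hb0.
have hGj j : wiener_bound (G - \sum_(0 <= k < j) F ^+ k) (M * (c ^+ j / (1 - c))).
  exists (fun n => b n - \sum_(0 <= k < j) a k n) => // z.
  have h := fourier_expansion_sum j (fun k => (ha k).1).
  apply: (eq_hsum _ (hsumB (hG z) (h z))) => n.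
  by rewrite scalerBr.
have hF1 : wiener_bound (1 - F) (M + c) by apply: wiener_boundD wiener_bound1 (wiener_boundN hF).
have FS j : (1 - F) * \sum_(0 <= k < j) F ^+ k = 1 - F ^+ j.
  by rewrite big_mkord -opprB mulNr -subrX1 opprB.
have SF j : \sum_(0 <= k < j) F ^+ k * (1 - F) = 1 - F ^+ j.
  rewrite -FS -mulr_suml; apply: commr_sym; apply: commr_sum => k _; apply: commr_sym.
  by apply: commrB; [exact: commr1|apply: commr_sym; exact: commrX].
have rest e : 0 < e -> exists j, (M + c) * (M * (c ^+ j / (1 - c))) + M * c ^+ j <= e.
  move=> e0; have d0 : 0 < e / (M + c + 1) by rewrite divr_gt0 // ltr_wpDl // addr_ge0.
  have [j hj] := small _ d0; exists j.
  have : M * c ^+ j <= M * (c ^+ j / (1 - c)).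
    by rewrite ler_wpM2l // ler_peMr ?exprn_ge0 // invf_ge1 //; lra.
  move: hj; rewrite ltr_pdivlMr ?ltr_wpDl // ?addr_ge0 //; lra.
exists G; split; first by exists b.
  apply/eqP; rewrite -subr_eq0; apply/eqP/wiener_bound_eq0 => e /rest [j hj].
  apply: wiener_bound_le hj _.
  have -> : G * (1 - F) - 1 = (G - \sum_(0 <= k < j) F ^+ k) * (1 - F) + - F ^+ j.
    by rewrite mulrBl mulr_suml SF opprB -addrA [F ^+ j - 1 - _]addrAC subrr sub0r.
  rewrite [(M + c) * _]mulrC.
  exact: wiener_boundD (wiener_boundM (hGj j) hF1) (wiener_boundN (hX j)).
apply/eqP; rewrite -subr_eq0; apply/eqP/wiener_bound_eq0 => e /rest [j hj].
apply: wiener_bound_le hj _.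
have -> : (1 - F) * G - 1 = (1 - F) * (G - \sum_(0 <= k < j) F ^+ k) + - F ^+ j.
  by rewrite mulrBr FS opprB -addrA [F ^+ j - 1 - _]addrAC subrr sub0r.
exact: wiener_boundD (wiener_boundM hF1 (hGj j)) (wiener_boundN (hX j)).
Qed.

End FourierAlgebra.

(** * One-sided inverses in the Fourier algebra for subexponential weights *)

Lemma expr_converse (T : nzRingType) (x : T) n : (x : T^c) ^+ n = x ^+ n.
Proof. by elim: n => // n IH; rewrite [LHS]exprSr IH exprS. Qed.

Section WienerInverse.
Variables (R : realType) (A : banachAlgebra R) (p q W : R) (w : int -> R).
Hypotheses (p_gt1 : 1 < p) (pq : p^-1 + q^-1 = 1).
Hypothesis w_ge1 : forall n, 1 <= w n.
Hypothesis w_conv : forall n (s : seq int), uniq s ->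
  \sum_(k <- s) w k `^ (- q) * w (n - k) `^ (- q) <= w n `^ (- q).
Hypothesis w_sum : sums_le (fun n => w n `^ (- q)) W.
Hypothesis w_subexp : forall r : R, 1 < r -> exists C, forall n : nat,
  w n%:Z <= C * r ^+ n /\ w (- n%:Z) <= C * r ^+ n.

Local Notation T := (R[i]^o -> A).
Local Notation bnd := (@wiener_bound R A p w).
Local Notation sc := (@const_fun R A).
Local Notation mono := (@monomial R A).

Lemma rnorm1_gt0 : 0 < rnorm (1 : A).
Proof.
rewrite lt_neqAle rnorm_ge0 andbT eq_sym.
by apply/eqP => /rnorm0_eq0/eqP; rewrite oner_eq0.
Qed.

Lemma wiener_bounded_ring : bounded_ring (T := (R[i]^o -> A)) bnd sc.
Proof.
have w0 : 0 < w 0 by exact: lt_le_trans ltr01 (w_ge1 0).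
have M0 : 0 < rnorm (1 : A) * w 0 by rewrite mulr_gt0 // rnorm1_gt0.
split.
- exact: wiener_bound_ge0.
- exact: wiener_bound_le.
- exact: wiener_boundD.
- exact: wiener_boundN.
- exact: (wiener_boundM p_gt1 pq w_ge1 w_conv w_sum).
- by exists (rnorm (1 : A) * w 0) => // z; exact: wiener_bound_const.
- by move=> z t; apply/funext => x; rewrite /const_fun scalerBl.
- by move=> z t; apply/funext => x; rewrite [RHS](_ : _ = z%:A * t%:A) // -scalerAl mul1r scalerA.
- by apply/funext => x; rewrite /const_fun scale1r.
- by move=> z x; apply/funext => y; rewrite [LHS](_ : _ = z%:A * x y) // mulr_algl -mulr_algr.
- by exists (rnorm (1 : A) * w 0) => // F c; exact: (wiener_neumann p_gt1 pq w_ge1 w_conv w_sum).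
Qed.

Lemma monomialM n m x y : mono n x * mono m y = mono (n + m) (x * y).
Proof.
apply/funext => z.
rewrite [LHS](_ : _ = (to_circle z ^ n *: x) * (to_circle z ^ m *: y)) //.
by rewrite -scalerAl -scalerAr scalerA -expfzDr // to_circle_neq0.
Qed.

Lemma monomialB n x y : mono n x - mono n y = mono n (x - y).
Proof. by apply/funext => z; rewrite [RHS]scalerBr. Qed.

Lemma monomialD n x y : mono n (x + y) = mono n x + mono n y.
Proof. by apply/funext => z; rewrite [LHS]scalerDr. Qed.

Lemma monomialN n x : mono n (- x) = - mono n x.
Proof. by apply/funext => z; rewrite [LHS]scalerN. Qed.

Lemma circle_expiV (t : R) : circle (expi t)^-1.
Proof.
rewrite /circle /= -[LHS]/(nc _)%:C Normc.normcV normc_expi invr1 //.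
Qed.

Lemma monomial01 : mono 0 1 = 1.
Proof. by apply/funext => z; rewrite /monomial expr0z scale1r. Qed.

Lemma const_monomial z : sc z = mono 0 z%:A.
Proof. by apply/funext => t; rewrite /monomial expr0z scale1r. Qed.

Lemma const_monomial1X z m n : (sc z * mono m 1) ^+ n = mono (m * n%:Z) (z ^+ n)%:A.
Proof.
elim: n => [|n IH]; first by rewrite mulr0 !expr0 scale1r monomial01.
rewrite exprS IH const_monomial !monomialM add0r mulr1.
rewrite -scalerAl mul1r scalerA -exprS; congr monomial; lia.
Qed.

Let u : T := mono 1 1.
Let v : T := mono (-1) 1.

Lemma circle_shift_comm (F : T) : u * F = F * u.
Proof.
apply/funext => z; rewrite [LHS](_ : _ = (to_circle z ^ 1)%:A * F z) //.
by rewrite mulr_algl -mulr_algr.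
Qed.

Lemma circle_shift_inv : u * v = 1.
Proof. by rewrite /u /v monomialM mulr1 subrr monomial01. Qed.

Lemma circle_shift_growth (r e : R) : 0 < r < 1 -> 0 < e ->
  exists2 n, (0 < n)%N & bnd ((sc r%:C * u) ^+ n) e /\ bnd ((sc r%:C * v) ^+ n) e.
Proof.
(* A rate with 1 < s < 1/r: the weights grow at most like C s^n, so the norms in question decay like
   (r s)^n. *)
move=> /andP[r0 r1] e0; pose s := 2 / (1 + r).
have r1' : 0 < 1 + r by rewrite addr_gt0.
have s1 : 1 < s by rewrite /s ltr_pdivlMr //; lra.
have s0 : 0 < s by exact: lt_trans ltr01 s1.
have [C hC] := w_subexp s1; have C0 : 0 < C.
  have [h _] := hC 0%N; rewrite expr0 mulr1 in h.
  by apply: lt_le_trans h; exact: lt_le_trans ltr01 (w_ge1 0).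
have rs0 : 0 <= r * s by rewrite mulr_ge0 ?ltW.
have rs1 : r * s < 1 by rewrite /s mulrA ltr_pdivrMr //; lra.
have N0 := rnorm1_gt0.
have e1 : 0 < e / (rnorm (1 : A) * C) by rewrite divr_gt0 // mulr_gt0.
have [N hN] := expr_small rs0 rs1 e1.
have hn := hN N.+1 (leqnSn N); exists N.+1 => //.
have key (m : int) : w m <= C * s ^+ N.+1 -> bnd (mono m (r%:C ^+ N.+1)%:A) e.
  move=> hm; apply: (wiener_bound_le p_gt1) (wiener_bound_monomial p_gt1 w_ge1 _ _).
  rewrite rnormZ -rmorphXn normc_realE ger0_norm ?exprn_ge0 ?(ltW r0) //.
  apply: (@le_trans _ _ (r ^+ N.+1 * rnorm (1 : A) * (C * s ^+ N.+1))).
    by rewrite ler_wpM2l // mulr_ge0 ?exprn_ge0 // ltW.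
  move: hn; rewrite ltr_pdivlMr ?mulr_gt0 // exprMn => h.
  apply: le_trans (ltW h); rewrite le_eqVlt; apply/orP; left; apply/eqP; ring.
have [h1 h2] := hC N.+1.
rewrite /u /v !const_monomial1X; split; apply: key; first by rewrite mul1r.
by rewrite mulN1r.
Qed.

Section Expansion.
Variables (F : T) (a : int -> A) (c : R).
Hypotheses (Fa : fourier_expansion F a) (ac : lp_le p w (fun n => rnorm (a n)) c).

(** The Laurent polynomial z^n - m^-n vanishes at the zero m^-1 of 1 - m z. The quotient is a
    geometric sum, with the factor z^n taken out when n is negative. *)
Lemma monomial_divisible m n x : m != 0 ->
  exists2 h, bounded bnd h & mono n x - mono 0 (m^-1 ^ n *: x) = h * (1 - sc m * u).
Proof.
move=> m0; have B := wiener_bounded_ring.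
have bmono k y : bounded bnd (mono k y).
  by eexists; exact: (wiener_bound_monomial p_gt1 w_ge1).
have bsum k : bounded bnd (\sum_(j < k) (sc m * u) ^+ j).
  apply: (bounded_sum B) => j; rewrite const_monomial1X; exact: bmono.
have geo k : (\sum_(j < k) (sc m * u) ^+ j) * (1 - sc m * u) = 1 - (sc m * u) ^+ k.
  have cm : GRing.comm (\sum_(j < k) (sc m * u) ^+ j) (1 - sc m * u).
    apply: commrB; first exact: commr1.
    by apply: commr_sym; apply: commr_sum => i _; apply: commrX.
  by rewrite cm -opprB mulNr -subrX1 opprB.
case: n => k.
  exists (mono 0 (- (m^-1 ^ k *: x)) * \sum_(j < k) (sc m * u) ^+ j).
    exact: (boundedM B (bmono _ _) (bsum _)).
  rewrite -mulrA geo const_monomial1X mulrBr mulr1 monomialM add0r mul1r.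
  rewrite mulr_algr scalerN !monomialN opprK addrC; congr (_ + mono k _).
  by rewrite scalerA -exprnP -exprMn mulfV // expr1n scale1r.
exists (mono (Negz k) x * \sum_(j < k.+1) (sc m * u) ^+ j).
  exact: (boundedM B (bmono _ _) (bsum _)).
rewrite -mulrA geo const_monomial1X mulrBr mulr1 monomialM mul1r mulr_algr.
congr (_ - mono _ (_ *: _)); first by rewrite NegzE addNr.
by rewrite NegzE -exprnN exprVn invrK.
Qed.

(** For a trigonometric polynomial [F0] close to [F], the difference of [F0] and the constant
    F0(m^-1) is divisible by 1 - m u. The error consists of F - F0 and its value at m^-1. *)
Lemma local_approximation m e : nc m = 1 -> 0 < e ->
  exists2 h, bounded bnd h & bnd (F - mono 0 (F m^-1) - h * (1 - sc m * u)) e.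
Proof.
move=> m1 e0; have B := wiener_bounded_ring.
have m0 : m != 0 by apply: contra_eq_neq m1 => ->; rewrite Normc.normc0 eq_sym oner_neq0.
have W0 := sums_le_ge0 w_sum.
have w0 : 0 <= w 0 by exact: le_trans ler01 (w_ge1 0).
have K0 : 0 < 1 + (1 + W) * w 0 by rewrite ltr_pwDl // mulr_ge0 // addr_ge0.
(* The value of F - F0 is at most d (1 + W), and as a constant function it picks up the factor
   [w 0]. *)
pose d := e / (1 + (1 + W) * w 0).
have d0 : 0 < d by rewrite divr_gt0.
have [s us hs] := lp_le_tail p_gt1 ac d0.
pose F0 : T := \sum_(n <- s) mono n (a n).
have hF0 : bnd (F - F0) d.
  exists (fun n => if n \in s then 0 else a n); last first.
    by apply: (lp_leS p_gt1) hs => n; rewrite rnorm_ge0 /=; case: ifP; rewrite ?rnorm0.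
  move=> z; have hz : hsum (fun n => to_circle z ^ n *: (if n \in s then a n else 0)) (F0 z).
    rewrite /F0 fct_sumE.
    have -> : \sum_(n <- s) mono n (a n) z =
        \sum_(n <- s) to_circle z ^ n *: (if n \in s then a n else 0).
      by rewrite big_seq [RHS]big_seq; apply: eq_bigr => n ->.
    by apply: hsum_finite => // n /negbTE ->; rewrite scaler0.
  apply: (eq_hsum _ (hsumB (Fa z) hz)) => n.
  by case: ifP; rewrite ?subrr ?scaler0 ?subr0.
have cm : to_circle m^-1 = m^-1.
  rewrite /to_circle (_ : `|m^-1| = 1) ?eqxx //.
  by rewrite -[LHS]/(nc m^-1)%:C Normc.normcV m1 invr1.
have [h hh hE] : exists2 h, bounded bnd h & F0 - mono 0 (F0 m^-1) = h * (1 - sc m * u).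
  rewrite /F0; elim: (s) => [|n t [h hh IH]].
    exists 0; first exact: (bounded0 B).
    rewrite big_nil mul0r sub0r; apply/funext => z.
    by rewrite [LHS](_ : _ = - (to_circle z ^ 0 *: 0)) // scaler0 oppr0.
  have [k hk kE] := monomial_divisible n (a n) m0.
  exists (k + h); first exact: (boundedD B).
  rewrite big_cons mulrDl -kE -IH.
  rewrite [(mono n (a n) + _) m^-1](_ : _ =
    to_circle m^-1 ^ n *: a n + (\sum_(n <- t) mono n (a n)) m^-1) // cm.
  by rewrite monomialD opprD addrACA.
exists h => //.
have -> : F - mono 0 (F m^-1) - h * (1 - sc m * u) = (F - F0) + mono 0 (- ((F - F0) m^-1)).
  rewrite -hE monomialN.
  have -> : mono 0 ((F - F0) m^-1) = mono 0 (F m^-1) - mono 0 (F0 m^-1) by rewrite monomialB.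
  by rewrite !opprB [LHS]addrACA [RHS]addrACA; congr (_ + _); rewrite addrC.
apply: (wiener_bound_le p_gt1)
  (wiener_boundD p_gt1 w_ge1 hF0 (wiener_bound_monomial p_gt1 w_ge1 0 _)).
rewrite rnormN; have h1 := wiener_bound_sup p_gt1 pq w_ge1 w_sum m^-1 hF0.
have : rnorm ((F - F0) m^-1) * w 0 <= d * (1 + W) * w 0 by rewrite ler_wpM2r.
have : d * (1 + (1 + W) * w 0) = e by rewrite divfK // gt_eqF.
lra.
Qed.

Lemma wiener_left_inverse : (forall z, circle z -> exists b, b * F z = 1) ->
  exists2 G, bounded bnd G & G * F = 1.
Proof.
move=> hinv; have B := wiener_bounded_ring.
apply: (left_inverse_of_local B circle_shift_comm circle_shift_inv) => //.
- by eexists; exact: (wiener_bound_monomial p_gt1 w_ge1).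
- exact: circle_shift_growth.
move=> t; have [b hb] := hinv (expi t)^-1 (circle_expiV t).
exists (mono 0 b), (mono 0 (F (expi t)^-1)); split.
- by eexists; exact: (wiener_bound_monomial p_gt1 w_ge1).
- by rewrite monomialM hb addr0 monomial01.
- by move=> e e0; apply: local_approximation => //; exact: normc_expi.
Qed.

Lemma wiener_right_inverse : (forall z, circle z -> exists b, F z * b = 1) ->
  exists2 G, bounded bnd G & F * G = 1.
Proof.
move=> hinv; have B := wiener_bounded_ring.
have Bc := bounded_ring_converse B.
have uC (G : T^c) : (u : T^c) * G = G * u by exact/esym/circle_shift_comm.
have uv : (u : T^c) * v = 1.
  by rewrite -[LHS]/((v : T) * u) -circle_shift_comm circle_shift_inv.
apply: (left_inverse_of_local Bc uC uv) => //.
- by eexists; exact: (wiener_bound_monomial p_gt1 w_ge1).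
- move=> r e r01 e0; have [n n0 [h1 h2]] := circle_shift_growth r01 e0.
  exists n => //; rewrite !expr_converse -![(sc _ : T^c) * _]/((_ : T) * sc _).
  by rewrite -!(sc_comm B).
move=> t; have [b hb] := hinv (expi t)^-1 (circle_expiV t).
exists (mono 0 b), (mono 0 (F (expi t)^-1)); split.
- by eexists; exact: (wiener_bound_monomial p_gt1 w_ge1).
- by rewrite -[LHS]/((_ : T) * mono 0 b) monomialM hb addr0 monomial01.
move=> e e0; have [h hh hE] := local_approximation (normc_expi t) e0.
exists h => //.
(* In the converse ring the multiplier stands on the other side; as [u] and the scalars are central,
   the same [h] serves. *)
have E : h * (1 - sc (expi t) * u) = (1 - u * sc (expi t)) * h :> T.
  rewrite mulrBl mulrBr mul1r mulr1 circle_shift_comm; congr (_ - _).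
  by rewrite -[RHS]mulrA circle_shift_comm !mulrA (sc_comm B).
by move: hE; rewrite E.
Qed.

End Expansion.
End WienerInverse.

(** * Fourier coefficients *)

Section RiemannSums.
Variable R : realType.
Implicit Types (a b d k : R) (s : seq R) (xi : nat -> R).

Definition tagged_mesh a b s xi d := forall i, (i < size s)%N ->
  [/\ nth b (a :: s) i <= xi i, xi i <= nth b s i &
      nth b s i - nth b (a :: s) i < d].

Lemma sum_steps a b s : last a s = b ->
  \sum_(i < size s) (nth b s i - nth b (a :: s) i) = b - a.
Proof.
move=> sb; rewrite -(big_mkord xpredT (fun i => nth b (a :: s) i.+1 - nth b (a :: s) i)).
by rewrite telescope_sumr // -[X in X - _ = _]/(nth b (a :: s) (size (a :: s)).-1) nth_last /= sb.
Qed.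

Lemma derive1_mean_value (f df : R -> R) (x y : R) : x <= y ->
  (forall t : R, is_derive t 1 f (df t)) ->
  exists2 c, x <= c <= y & f y - f x = df c * (y - x).
Proof.
move=> xy hf; have [|c] := @MVT_segment R f df x y xy (fun t _ => hf t).
  apply: continuous_subspaceT => t.
  by apply: differentiable_continuous; apply/derivable1_diffP; case: (hf t).
by rewrite in_itv /= => hc e; exists c.
Qed.

Lemma cos_lipschitz (x y : R) : `|cos x - cos y| <= `|x - y|.
Proof.
wlog xy : x y / x <= y.
  by move=> h; case: (leP x y) => [/h //|/ltW /h]; rewrite distrC (distrC y).
have [c _] := derive1_mean_value xy (fun t => is_derive_cos t).
rewrite distrC (distrC x) => ->; rewrite normrM normrN ler_piMl //.
exact: sin_max.
Qed.

Lemma sin_lipschitz (x y : R) : `|sin x - sin y| <= `|x - y|.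
Proof.
wlog xy : x y / x <= y.
  by move=> h; case: (leP x y) => [/h //|/ltW /h]; rewrite distrC (distrC y).
have [c _] := derive1_mean_value xy (fun t => is_derive_sin t).
rewrite distrC (distrC x) => ->; rewrite normrM ler_piMl //.
exact: cos_max.
Qed.

(** Mean value theorem with a 1-Lipschitz derivative: moving the intermediate point to k t costs at
    most |k (y - x)|. For negative k the end points change places. *)
Lemma scaled_increment (f df : R -> R) k (x y t : R) :
  (forall u : R, is_derive u 1 f (df u)) -> (forall u v, `|df u - df v| <= `|u - v|) ->
  x <= t -> t <= y ->
  `|f (k * y) - f (k * x) - k * df (k * t) * (y - x)| <= k ^+ 2 * (y - x) ^+ 2.
Proof.
move=> hf hdf xt ty.
have inc u v c : u <= c -> c <= v -> `|f v - f u - df c * (v - u)| <= (v - u) ^+ 2.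
  move=> uc cv; have uv : u <= v by exact: le_trans cv.
  have d0 : 0 <= v - u by rewrite subr_ge0.
  have [e /andP[ue ev] ->] := derive1_mean_value uv hf.
  rewrite -mulrBl normrM (ger0_norm d0) expr2 ler_wpM2r //.
  by apply: le_trans (hdf _ _) _; rewrite ler_norml; lra.
rewrite -exprMn [k * (y - x)]mulrBr; have [k0|k0] := leP 0 k.
  have := inc (k * x) (k * y) (k * t) (ler_wpM2l k0 xt) (ler_wpM2l k0 ty).
  by congr (`|_| <= _); ring.
have := inc (k * y) (k * x) (k * t) (ler_wnM2l (ltW k0) ty) (ler_wnM2l (ltW k0) xt).
rewrite -sqrrN opprB -normrN.
by congr (`|_| <= _); ring.
Qed.

(* The sum approximates a multiple of [expi (k * b) - expi (k * a) = 0]. *)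
Lemma riemann_sum_expi a b s xi d k : last a s = b -> tagged_mesh a b s xi d ->
  expi (k * b) = expi (k * a) -> k != 0 ->
  nc (\sum_(i < size s) (nth b s i - nth b (a :: s) i)%:C * expi (k * xi i))
    <= 2 * `|k| * d * (b - a).
Proof.
move=> sb hs hk k0.
pose D i := nth b s i - nth b (a :: s) i.
have D0 (i : 'I_(size s)) : 0 <= D i.
  by have [h1 h2 _] := hs i (ltn_ord i); rewrite subr_ge0 (le_trans h1 h2).
have Dd (i : 'I_(size s)) : D i <= d by have [_ _ /ltW] := hs i (ltn_ord i).
have k0' : 0 < `|k| by rewrite normr_gt0.
have main (f df : R -> R) : (forall u : R, is_derive u 1 f (df u)) ->
    (forall u v, `|df u - df v| <= `|u - v|) -> f (k * b) = f (k * a) ->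
    `|\sum_(i < size s) D i * df (k * xi i)| <= `|k| * d * (b - a).
  move=> hf hdf fab; rewrite -(ler_pM2l k0') -normrM mulr_sumr.
  have tele : \sum_(i < size s) (f (k * nth b s i) - f (k * nth b (a :: s) i)) = 0.
    rewrite -(big_mkord xpredT (fun i => f (k * nth b (a :: s) i.+1) - f (k * nth b (a :: s) i))).
    rewrite (telescope_sumr (fun i => f (k * nth b (a :: s) i))) //.
    by rewrite -[X in f (k * X) - _]/(nth b (a :: s) (size (a :: s)).-1) nth_last /= sb fab subrr.
  have -> : `|\sum_(i < size s) k * (D i * df (k * xi i))| =
      `|\sum_(i < size s) (f (k * nth b s i) - f (k * nth b (a :: s) i)
                           - k * (D i * df (k * xi i)))|.
    by rewrite sumrB tele sub0r normrN.
  apply: le_trans (ler_norm_sum _ _ _) _.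
  apply: (@le_trans _ _ (\sum_(i < size s) k ^+ 2 * d * D i)); last first.
    rewrite -mulr_sumr sum_steps // -(real_normK (num_real k)) expr2 le_eqVlt.
    by apply/orP; left; apply/eqP; ring.
  apply: ler_sum => i _.
  have [h1 h2 _] := hs i (ltn_ord i).
  have := scaled_increment k hf hdf h1 h2.
  rewrite -[nth b s i - _]/(D i) (mulrC _ (D i)) mulrCA => h.
  apply: le_trans h _; rewrite expr2 mulrA ler_wpM2r //.
  by rewrite ler_wpM2l // sqr_ge0.
have [hc hs'] : cos (k * b) = cos (k * a) /\ sin (k * b) = sin (k * a).
  by case: hk.
apply: le_trans (normc_le_abs _) _.
have -> : complex.Re (\sum_(i < size s) (D i)%:C * expi (k * xi i)) =
    \sum_(i < size s) D i * cos (k * xi i).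
  rewrite (big_morph (@complex.Re R) (id1 := 0) (op1 := +%R)) => [|[? ?] [? ?]|] //.
  by apply: eq_bigr => i _; rewrite /= mul0r subr0.
have -> : complex.Im (\sum_(i < size s) (D i)%:C * expi (k * xi i)) =
    \sum_(i < size s) D i * sin (k * xi i).
  rewrite (big_morph (@complex.Im R) (id1 := 0) (op1 := +%R)) => [|[? ?] [? ?]|] //.
  by apply: eq_bigr => i _; rewrite /= mul0r addr0.
have h1 := main sin cos (fun t => is_derive_sin t) cos_lipschitz hs'.
have h2 := main cos (fun t => - sin t) (fun t => is_derive_cos t) _ hc.
have {h2} : `|\sum_(i < size s) D i * sin (k * xi i)| <= `|k| * d * (b - a).
  rewrite -normrN -sumrN.
  under eq_bigr do rewrite -mulrN.
  apply: h2 => u v; rewrite -opprD normrN; exact: sin_lipschitz.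
lra.
Qed.

(** Keeps the definition of the integral from being vacuous, so that its value is unique. The
    witness has equal steps, more than (b - a) / d in number, tagged at their left ends. *)
Lemma exists_fine_partition a b d : a < b -> 0 < d ->
  exists s xi, itv_partition a b s /\ tagged_mesh a b s xi d.
Proof.
move=> ab d0; have ba0 : 0 < b - a by rewrite subr_gt0.
pose N := (Num.trunc ((b - a) / d)).+1.
have N0 : 0 < N%:R :> R by rewrite ltr0n.
have Nd : (b - a) / N%:R < d.
  by rewrite ltr_pdivrMr // mulrC -ltr_pdivrMr // truncnS_gt.
pose g (k : nat) := a + (b - a) * k%:R / N%:R.
have g0 : g 0%N = a by rewrite /g mulr0 mul0r addr0.
have gN : g N = b by rewrite /g mulfK ?gt_eqF // addrC subrK.
have gS (k : nat) : g k.+1 - g k = (b - a) / N%:R by rewrite /g -natr1; ring.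
have g_homo : {homo g : i j / (i < j)%N >-> (i < j)%R}.
  by move=> i j ij; rewrite /g ltrD2l ltr_pM2r ?invr_gt0 // ltr_pM2l // ltr_nat.
pose s := [seq g i | i <- iota 1 N].
have sz : size s = N by rewrite size_map size_iota.
have asE : a :: s = [seq g i | i <- iota 0 N.+1] by rewrite /= g0.
have nth1 i : (i < N)%N -> nth b (a :: s) i = g i.
  by move=> iN; rewrite asE (nth_map 0%N) ?size_iota ?nth_iota // ltnW.
have nth2 i : (i < N)%N -> nth b s i = g i.+1.
  by move=> iN; rewrite (nth_map 0%N) ?size_iota ?nth_iota.
exists s, g; split.
  split.
    rewrite -g0 path_map; have := iota_ltn_sorted 0 N.+1.
    by apply: sub_path => i j; exact: g_homo.
  apply/eqP; rewrite -[LHS]/(last b (a :: s)) -nth_last asE.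
  by rewrite size_map size_iota (nth_map 0%N) ?size_iota // nth_iota.
move=> i; rewrite sz => iN; rewrite nth1 // nth2 // gS; split => //.
by rewrite ltW // g_homo.
Qed.

End RiemannSums.

Section RiemannIntegral.
Variables (R : realType) (V : normedModType R[i]).

Lemma is_riemann_integral_unique (a b : R) (F : R -> V) I J : a < b ->
  is_riemann_integral a b F I -> is_riemann_integral a b F J -> I = J.
Proof.
move=> ab hI hJ; apply/eqP; rewrite -subr_eq0; apply/eqP/rnorm_lt_eq0 => e e0.
have e2 : 0 < e / 2 by rewrite divr_gt0.
have [d1 d10 h1] := hI _ e2; have [d2 d20 h2] := hJ _ e2.
have d0 : 0 < Num.min d1 d2 by rewrite lt_min d10.
have [s [xi [hs hxi]]] := exists_fine_partition ab d0.
have m1 := h1 s xi hs; have m2 := h2 s xi hs.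
set S := \sum_(i < size s) _ in m1 m2.
have -> : I - J = (S - J) - (S - I) by rewrite opprB [RHS]addrC addrA subrK.
apply: le_lt_trans (rnormB _ _) _.
have {}m1 : rnorm (S - I) < e / 2.
  by apply: m1 => i /hxi [? ?]; rewrite lt_min => /andP[].
have {}m2 : rnorm (S - J) < e / 2.
  by apply: m2 => i /hxi [? ?]; rewrite lt_min => /andP[].
lra.
Qed.

Lemma riemann_integralE (a b : R) (F : R -> V) I : a < b ->
  is_riemann_integral a b F I -> riemann_integral a b F = I.
Proof.
move=> ab hI; apply: (is_riemann_integral_unique ab _ hI).
by apply: (xgetPex 0); exists I.
Qed.

End RiemannIntegral.

Section FourierCoefficients.
Variables (R : realType) (A : banachAlgebra R).

(** Up to a uniformly small rest, [g] is a finite sum over frequencies k. In every Riemann sum the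
    frequency k = n contributes exactly 2 pi b_n, while the others are of the order of the mesh. *)
Lemma is_riemann_integral_fourier (g : R[i] -> A) (b : int -> A) C n :
  (forall t, hsum (fun k => expi t ^ k *: b k) (g (expi t))) ->
  sums_le (fun k => rnorm (b k)) C ->
  is_riemann_integral 0 (2 * pi) (fun t => expi (- (n%:~R * t)) *: g (expi t))
    ((2 * pi)%:C *: b n).
Proof.
move=> hg hb e e0; have pi0 : 0 < 2 * pi :> R by rewrite mulr_gt0 // pi_gt0.
have e1 : 0 < e / (4 * pi) by rewrite divr_gt0 // mulr_gt0 // pi_gt0.
have [s0 us0 hs0] := sums_le_tail hb e1.
(* [n] is adjoined so that the main term belongs to the finite part. *)
pose s1 := undup (n :: s0).
have us1 : uniq s1 by exact: undup_uniq.
have ns1 : n \in s1 by rewrite mem_undup mem_head.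
have s01 : {subset s0 <= s1} by move=> k hk; rewrite mem_undup inE hk orbT.
(* Collects the bounds of [riemann_sum_expi] for the frequencies k - n on [0, 2 pi], apart from the
   mesh. *)
pose K := \sum_(k <- s1) 2 * `|(k - n)%:~R| * (2 * pi) * rnorm (b k).
have K0 : 0 <= K.
  by apply: sumr_ge0 => k _; rewrite !mulr_ge0 ?rnorm_ge0 // ltW // pi_gt0.
pose d := e / (2 * (K + 1)).
have d0 : 0 < d by rewrite divr_gt0 // mulr_gt0 // ltr_wpDl.
exists d => // s xi [ps /eqP ls] hm.
pose D i := nth (2 * pi) s i - nth (2 * pi) (0 :: s) i.
have D0 (i : 'I_(size s)) : 0 <= D i.
  by have [h1 h2 _] := hm i (ltn_ord i); rewrite subr_ge0 (le_trans h1 h2).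
have Dsum : \sum_(i < size s) D i = 2 * pi by rewrite sum_steps // subr0.
pose P t := \sum_(k <- s1) expi t ^ k *: b k.
have rest t : rnorm (g (expi t) - P t) <= e / (4 * pi).
  have hP : hsum (fun k => expi t ^ k *: (if k \in s1 then b k else 0)) (P t).
    have -> : P t = \sum_(k <- s1) expi t ^ k *: (if k \in s1 then b k else 0).
      by rewrite /P big_seq [RHS]big_seq; apply: eq_bigr => k ->.
    by apply: hsum_finite => // k /negbTE ->; rewrite scaler0.
  apply: hsum_rnorm_le (hsumB (hg t) hP) _ => r ur.
  apply: (@le_trans _ _ (\sum_(k <- r | k \notin s1) rnorm (b k))).
    rewrite [leRHS]big_mkcond; apply: ler_sum => k _; rewrite -scalerBr rnormZ.
    by rewrite -expi_intmul normc_expi mul1r; case: ifP; rewrite ?subrr ?rnorm0 ?subr0.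
  rewrite -big_filter; apply: hs0 => [|k]; first exact: filter_uniq.
  by rewrite mem_filter => /andP[hk _]; apply: contra hk; exact: s01.
have main : rnorm (\sum_(i < size s) (D i)%:C *: (expi (- (n%:~R * xi i)) *: P (xi i))
    - (2 * pi)%:C *: b n) <= d * K.
  have -> : \sum_(i < size s) (D i)%:C *: (expi (- (n%:~R * xi i)) *: P (xi i)) =
      \sum_(k <- s1) (\sum_(i < size s) (D i)%:C * expi ((k - n)%:~R * xi i)) *: b k.
    under [RHS]eq_bigr do rewrite scaler_suml.
    rewrite exchange_big; apply: eq_bigr => i _ /=.
    rewrite !scaler_sumr; apply: eq_bigr => k _; rewrite !scalerA; congr (_ *: _).
    rewrite -expi_intmul -mulrA -expiD; congr (_ * expi _).
    by rewrite intrB; ring.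
  rewrite (bigD1_seq n) //= subrr.
  have -> : \sum_(i < size s) (D i)%:C * expi (0%:~R * xi i) = (2 * pi)%:C.
    rewrite -Dsum rmorph_sum; apply: eq_bigr => i _.
    by rewrite mul0r expi0 mulr1.
  rewrite addrAC subrr add0r -big_filter; apply: le_trans (rnorm_sum _ _) _.
  rewrite /K mulr_sumr big_filter [leRHS](bigID (fun k => k != n)) /=.
  rewrite -[leLHS]addr0; apply: lerD; last first.
    apply: sumr_ge0 => k _; apply: mulr_ge0; first exact: ltW.
    by rewrite !mulr_ge0 ?rnorm_ge0 // ltW // pi_gt0.
  apply: ler_sum => k kn; rewrite rnormZ mulrA ler_wpM2r ?rnorm_ge0 //.
  have k0 : (k - n)%:~R != 0 :> R by rewrite intr_eq0 subr_eq0.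
  have per : expi ((k - n)%:~R * (2 * pi)) = expi ((k - n)%:~R * 0) :> R[i].
    by rewrite expi_intmul expi_2pi exp1rz mulr0 expi0.
  have := riemann_sum_expi ls hm per k0; rewrite subr0 => h; apply: le_trans h _.
  by rewrite le_eqVlt; apply/orP; left; apply/eqP; ring.
have -> : \sum_(i < size s) (D i)%:C *: (expi (- (n%:~R * xi i)) *: g (expi (xi i))) =
    \sum_(i < size s) (D i)%:C *: (expi (- (n%:~R * xi i)) *: P (xi i)) +
    \sum_(i < size s) (D i)%:C *: (expi (- (n%:~R * xi i)) *: (g (expi (xi i)) - P (xi i))).
  by rewrite -big_split; apply: eq_bigr => i _ /=; rewrite -!scalerDr subrKC.
rewrite addrAC; apply: le_lt_trans (rnormD _ _) _.
have tail : rnorm (\sum_(i < size s) (D i)%:C *: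
    (expi (- (n%:~R * xi i)) *: (g (expi (xi i)) - P (xi i)))) <= e / 2.
  apply: le_trans (rnorm_sum _ _) _.
  have -> : e / 2 = \sum_(i < size s) D i * (e / (4 * pi)).
    rewrite -mulr_suml Dsum; have := pi_gt0 R; move: (pi : R) => x x0.
    by field; rewrite gt_eqF.
  apply: ler_sum => i _; rewrite !rnormZ normc_expi mul1r normc_realE ger0_norm //.
  by rewrite ler_wpM2l.
have dK : d * K < e / 2.
  have : d * (2 * (K + 1)) = e by rewrite divfK // gt_eqF // mulr_gt0 // ltr_wpDl.
  lra.
lra.
Qed.

Lemma fourier_coef_expansion (g : R[i] -> A) (b : int -> A) C n :
  (forall t, hsum (fun k => expi t ^ k *: b k) (g (expi t))) ->
  sums_le (fun k => rnorm (b k)) C -> fourier_coef g n = b n.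
Proof.
move=> hg hb; have pi0 : 0 < 2 * pi :> R by rewrite mulr_gt0 // pi_gt0.
rewrite /fourier_coef (riemann_integralE pi0 (is_riemann_integral_fourier n hg hb)).
by rewrite scalerA -rmorphM mulVf ?gt_eqF // scale1r.
Qed.

End FourierCoefficients.

Section EsumFinite.
Variables (R : realType) (I : choiceType) (x : I -> R).

Lemma esum_le_sums (C : R) : (\esum_(i in [set: I]) (x i)%:E <= C%:E)%E -> sums_le x C.
Proof.
move=> h s us; rewrite -lee_fin; apply: le_trans h.
apply: esum_ge; exists [set` s]; first by split.
by rewrite -fsbig_seq // sumEFin.
Qed.

Lemma sums_le_esum (C : R) : sums_le x C -> (\esum_(i in [set: I]) (x i)%:E <= C%:E)%E.
Proof.
move=> h; apply: ge_ereal_sup => _ [X [fX _] <-].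
by rewrite fsbig_finite //= sumEFin lee_fin; apply: h; exact: finmap.fset_uniq.
Qed.

Lemma esum_lty_sums : (forall i, 0 <= x i) -> (\esum_(i in [set: I]) (x i)%:E < +oo)%E ->
  exists C, sums_le x C.
Proof.
move=> x0 h; exists (fine (\esum_(i in [set: I]) (x i)%:E)).
apply: esum_le_sums; rewrite fineK // ge0_fin_numE //.
by apply: esum_ge0 => i _; rewrite lee_fin.
Qed.

End EsumFinite.

(** * Continuity of Fourier expansions on the circle *)

Section CircleContinuity.
Variables (R : realType) (A : banachAlgebra R).

Lemma to_circle_id (z : R[i]) : circle z -> to_circle z = z.
Proof. by rewrite /to_circle /circle /= => ->; rewrite eqxx. Qed.

Lemma normc_exprB (z t : R[i]) n : nc z = 1 -> nc t = 1 ->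
  nc (z ^+ n - t ^+ n) <= n%:R * nc (z - t).
Proof.
move=> z1 t1; elim: n => [|n IH]; first by rewrite subrr Normc.normc0 mul0r.
have -> : z ^+ n.+1 - t ^+ n.+1 = z * (z ^+ n - t ^+ n) + (z - t) * t ^+ n.
  by rewrite !exprS; ring.
apply: le_trans (le_normcD _ _) _.
rewrite !Normc.normcM z1 mul1r normcX t1 expr1n mulr1 -natr1 mulrDl mul1r.
by rewrite lerD2r.
Qed.

Lemma normc_exprzB (z t : R[i]) (n : int) : nc z = 1 -> nc t = 1 ->
  nc (z ^ n - t ^ n) <= `|n|%N%:R * nc (z - t).
Proof.
move=> z1 t1; case: n => n; first by rewrite -!exprnP; exact: normc_exprB.
have z0 : z != 0 by apply: contra_eq_neq z1 => ->; rewrite Normc.normc0 eq_sym oner_neq0.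
have t0 : t != 0 by apply: contra_eq_neq t1 => ->; rewrite Normc.normc0 eq_sym oner_neq0.
rewrite NegzE -!exprnN -!exprVn.
have -> : nc (z - t) = nc (z^-1 - t^-1).
  have -> : z^-1 - t^-1 = - ((z - t) * (z^-1 * t^-1)) by field; rewrite ?z0 ?t0.
  by rewrite normcN !Normc.normcM !Normc.normcV z1 t1 invr1 !mulr1.
by apply: normc_exprB; rewrite Normc.normcV ?z1 ?t1 invr1.
Qed.

(** [F] is uniformly close to the trigonometric polynomial [P], which is Lipschitz on the circle
    with constant [K]. *)
Lemma continuous_on_circle_expansion (F : R[i]^o -> A) (b : int -> A) C :
  fourier_expansion F b -> sums_le (fun n => rnorm (b n)) C ->
  continuous_on_circle F.
Proof.
move=> hF hb; apply/subspace_continuousP => x cx.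
apply/cvgrPdist_lt => e e0.
have eE : e = (complex.Re e)%:C by rewrite RRe_real // gtr0_real.
have {}e0 : 0 < complex.Re e by rewrite -ltcR -eE.
rewrite eE; move: (complex.Re e) e0 => r r0 {e eE}.
have r4 : 0 < r / 4 by rewrite divr_gt0.
have [s us hs] := sums_le_tail hb r4.
pose P z := \sum_(n <- s) to_circle z ^ n *: b n.
have rest z : rnorm (F z - P z) <= r / 4.
  have hP : hsum (fun k => to_circle z ^ k *: (if k \in s then b k else 0)) (P z).
    have -> : P z = \sum_(k <- s) to_circle z ^ k *: (if k \in s then b k else 0).
      by rewrite /P big_seq [RHS]big_seq; apply: eq_bigr => k ->.
    by apply: hsum_finite => // k /negbTE ->; rewrite scaler0.
  apply: hsum_rnorm_le (hsumB (hF z) hP) _ => t ut.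
  apply: (@le_trans _ _ (\sum_(k <- t | k \notin s) rnorm (b k))).
    rewrite [leRHS]big_mkcond; apply: ler_sum => k _; rewrite -scalerBr rnorm_to_circleZ.
    by case: ifP; rewrite ?subrr ?rnorm0 ?subr0.
  rewrite -big_filter; apply: hs => [|k]; first exact: filter_uniq.
  by rewrite mem_filter => /andP[].
pose K := \sum_(n <- s) `|n|%N%:R * rnorm (b n).
have K0 : 0 <= K by apply: sumr_ge0 => n _; rewrite mulr_ge0 ?rnorm_ge0.
have d0 : 0 < r / (4 * (K + 1)) by rewrite divr_gt0 // mulr_gt0 // ltr_wpDl.
have dE : r / (4 * (K + 1)) * (4 * (K + 1)) = r by rewrite divfK // gt_eqF // mulr_gt0 // ltr_wpDl.
have d0' : 0 < (r / (4 * (K + 1)))%:C :> R[i] by rewrite ltcR.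
rewrite near_withinE; near=> z => cz.
have hz : nc (x - z) < r / (4 * (K + 1)).
  have : ball x (r / (4 * (K + 1)))%:C z by near: z; apply: nbhsx_ballx.
  by rewrite -ball_normE /= -ltcR.
rewrite normE ltcR.
have hP : rnorm (P x - P z) <= K * nc (x - z).
  rewrite /P -sumrB; apply: le_trans (rnorm_sum _ _) _.
  rewrite /K mulr_suml; apply: ler_sum => n _.
  rewrite -scalerBl rnormZ mulrAC ler_wpM2r ?rnorm_ge0 // !to_circle_id //.
  have nc1 (y : R[i]) : circle y -> nc y = 1 by move=> [].
  by apply: normc_exprzB; exact: nc1.
rewrite -[X in rnorm X]/(F x - F z).
have -> : F x - F z = (F x - P x) + ((P x - P z) - (F z - P z)).
  have -> : P x - P z - (F z - P z) = P x - F z by rewrite opprB addrA subrK.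
  by rewrite addrA subrK.
apply: le_lt_trans (rnormD _ _) _.
have h1 := rnormB (P x - P z) (F z - P z).
have h2 := rest x; have h3 := rest z.
have h4 : K * nc (x - z) <= r / (4 * (K + 1)) * K by rewrite mulrC ler_wpM2r // ltW.
lra.
Unshelve. all: by end_near. Qed.

End CircleContinuity.

(** * Inversion of functions on the circle for subexponential weights *)

Section InverseSubexponential.
Variables (R : realType) (A : banachAlgebra R) (p q : R) (w : int -> R).

Definition subexponential := forall r : R, 1 < r -> exists C, forall n : nat,
  w n%:Z <= C * r ^+ n /\ w (- n%:Z) <= C * r ^+ n.

Hypotheses (p_gt1 : 1 < p) (pq : p^-1 + q^-1 = 1).
Hypothesis w_amaw : almost_monotone_algebra_weight q w.
Hypothesis w_subexp : subexponential.

Let w_ge1 n : 1 <= w n. Proof. by case: w_amaw => [[]]. Qed.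

Let w_conv n (s : seq int) : uniq s ->
  \sum_(k <- s) w k `^ (- q) * w (n - k) `^ (- q) <= w n `^ (- q).
Proof. by move=> us; have [_ [h _] _ _] := w_amaw; exact: (esum_le_sums (h n) us). Qed.

(** Absolute summability yields an unconditional sum; the symmetric partial sums tend both to it and
    to [f], so the two agree. Composition with [to_circle] discards the values of [f] off the
    circle. *)
Lemma fourier_expansion_of_abs_conv (f : R[i] -> A) : abs_conv_fourier p w f ->
  exists2 c, lp_le p w (fun n => rnorm (fourier_coef f n)) c &
    fourier_expansion (f \o @to_circle R) (fourier_coef f).
Proof.
move=> [fc fs].
have [C hC] : exists C, sums_le (fun n => rnorm (fourier_coef f n) `^ p * w n `^ p) C.
  by apply: esum_lty_sums fs => n; rewrite mulr_ge0 ?powR_ge0.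
have p0 : 0 < p := lt_trans ltr01 p_gt1.
have C0 := sums_le_ge0 hC.
have lp : lp_le p w (fun n => rnorm (fourier_coef f n)) (C `^ p^-1).
  split; first exact: powR_ge0.
  by rewrite -powRrM mulVf ?gt_eqF // powRr1.
have [_ [_ wfin] _ _] := w_amaw.
have [W hW] := esum_lty_sums (fun n => powR_ge0 (w n) (- q)) wfin.
exists (C `^ p^-1) => // z.
have [l hl] := hsum_exists (term_sums_le p_gt1 pq w_ge1 hW z lp).
have cz : circle (to_circle z).
  by rewrite /circle /= -[LHS]/(nc _)%:C normc_to_circle.
have h1 := fc _ cz; have h2 := hsum_partial hl.
have E : fourier_partial_sum f (to_circle z) =
    (fun N => \sum_(n <- int_range N) to_circle z ^ n *: fourier_coef f n).
  by apply/funext => N; rewrite big_int_range.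
rewrite E in h1.
have -> : (f \o @to_circle R) z = l by apply: cvg_unique h1 h2; exact: norm_hausdorff.
by [].
Qed.

Lemma wiener_boundP (G : R[i]^o -> A) c : wiener_bound p w G c ->
  continuous_on_circle G /\ abs_conv_fourier p w G.
Proof.
move=> [b hb hc].
have [_ [_ wfin] _ _] := w_amaw.
have [W hW] := esum_lty_sums (fun n => powR_ge0 (w n) (- q)) wfin.
have hs := coef_sums_le p_gt1 pq w_ge1 hW hc.
have hg t : hsum (fun k => expi t ^ k *: b k) (G (expi t)).
  have := hb (expi t); rewrite to_circle_id // /circle /=.
  by rewrite -[LHS]/(nc _)%:C normc_expi.
have cE n : fourier_coef G n = b n := fourier_coef_expansion n hg hs.
split; first exact: continuous_on_circle_expansion hb hs.
split.
  move=> z cz; have := hsum_partial (hb z); rewrite to_circle_id //.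
  have -> // : fourier_partial_sum G z =
    (fun N => \sum_(n <- int_range N) z ^ n *: b n).
  by apply/funext => N; rewrite big_int_range; apply: eq_bigr => k _; rewrite cE.
apply: le_lt_trans (ltry (c `^ p)); apply: sums_le_esum.
have [_ h] := hc; apply: sums_leS h => n; by rewrite cE.
Qed.

Theorem inverse_subexponential (f : R[i] -> A) s :
  abs_conv_fourier p w f ->
  (forall z, circle z -> exists b : A, is_inverse s (f z) b) ->
  exists g : R[i] -> A, [/\ continuous_on_circle g, abs_conv_fourier p w g &
    forall z, circle z -> is_inverse s (f z) (g z)].
Proof.
move=> /fourier_expansion_of_abs_conv [c lp hF] hinv.
have [_ [_ wfin] _ _] := w_amaw.
have [W hW] := esum_lty_sums (fun n => powR_ge0 (w n) (- q)) wfin.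
pose F : R[i]^o -> A := f \o @to_circle R.
have FE z : circle z -> F z = f z by move=> cz; rewrite /F /= to_circle_id.
have left : (forall z, circle z -> exists b, b * F z = 1) ->
    exists2 G, bounded (@wiener_bound R A p w) G & forall z, circle z -> G z * f z = 1.
  move=> /(wiener_left_inverse p_gt1 pq w_ge1 w_conv hW w_subexp hF lp) [G hG GF].
  by exists G => // z cz; rewrite -FE // -[LHS]/((G * F) z) GF.
have right : (forall z, circle z -> exists b, F z * b = 1) ->
    exists2 G, bounded (@wiener_bound R A p w) G & forall z, circle z -> f z * G z = 1.
  move=> /(wiener_right_inverse p_gt1 pq w_ge1 w_conv hW w_subexp hF lp) [G hG GF].
  by exists G => // z cz; rewrite -FE // -[LHS]/((F * G) z) GF.
case: s hinv => /= hinv.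
- have [|G [d /wiener_boundP [h1 h2]] hG] := left.
    by move=> z cz; rewrite FE //; exact: hinv.
  by exists G.
- have [|G [d /wiener_boundP [h1 h2]] hG] := right.
    by move=> z cz; rewrite FE //; exact: hinv.
  by exists G.
(* In the two-sided case the left inverse suffices: at each point it coincides with the given
   inverse. *)
have [|G [d /wiener_boundP [h1 h2]] hG] := left.
  by move=> z cz; rewrite FE //; have [b []] := hinv z cz; exists b.
exists G; split => // z cz; split; first exact: hG.
have [b [bf fb]] := hinv z cz.
by have -> : G z = b by rewrite -[LHS]mulr1 -fb mulrA hG // mul1r.
Qed.

End InverseSubexponential.

Lemma ler_sum_subseq (R : realType) (I : eqType) (s t : seq I) (F : I -> R) :
  uniq s -> uniq t -> {subset s <= t} -> (forall i, 0 <= F i) ->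
  \sum_(i <- s) F i <= \sum_(i <- t) F i.
Proof.
move=> us ut st F0; rewrite [leRHS](bigID (mem s)) /= -[leLHS]addr0; apply: lerD.
  rewrite -[leRHS]big_filter le_eqVlt; apply/orP; left; apply/eqP; apply: perm_big.
  apply: uniq_perm; rewrite ?filter_uniq // => i.
  by rewrite mem_filter; case: (boolP (i \in s)) => //= /st ->.
by apply: sumr_ge0 => i _.
Qed.

(** * Weights *)

Section SymmetricWeight.
Variables (R : realType) (q : R) (v : nat -> R) (K C W : R).
Hypotheses (q_gt0 : 0 < q) (K_gt0 : 0 < K).
Hypothesis v_ge1 : forall n, 1 <= v n.
Hypothesis v_mul : forall m n, v (m + n)%N <= K * (v m * v n).
Hypothesis v_mono : forall n k, v n <= K * v (n + k)%N.
Hypothesis v_conv : forall n,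
  \sum_(k <- iota 0 n.+1) v k `^ (- q) * v (n - k)%N `^ (- q) <= C * v n `^ (- q).
Hypothesis v_sum : sums_le (fun n => v n `^ (- q)) W.

Let V n := v n `^ (- q).

Let v_gt0 n : 0 < v n. Proof. exact: lt_le_trans ltr01 (v_ge1 n). Qed.
Let V_ge0 n : 0 <= V n. Proof. exact: powR_ge0. Qed.

Let V_mono n k : V (n + k)%N <= K `^ q * V n.
Proof.
have Kq : 0 < K `^ q by rewrite powR_gt0.
rewrite /V !powRN ler_pdivlMr ?powR_gt0 // mulrC ler_pdivrMr ?powR_gt0 //.
rewrite -powRM ?(ltW K_gt0) ?(ltW (v_gt0 _)) //.
apply: ge0_ler_powR; rewrite ?nnegrE ?(ltW q_gt0) ?(ltW (v_gt0 _)) //.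
by rewrite mulr_ge0 // ltW.
Qed.

Let V_le m n : (n <= m)%N -> V m <= K `^ q * V n.
Proof. by move=> /subnKC <-; exact: V_mono. Qed.

Lemma sum_absz_le : sums_le (fun k : int => V `|k|) (2 * W).
Proof.
move=> s us; rewrite (bigID (fun k : int => 0 <= k)) /= mulr2n mulrDl mul1r.
have part (P : pred int) : {in P &, injective absz} -> \sum_(k <- s | P k) V `|k|%N <= W.
  move=> Pi; rewrite -big_filter -(big_map absz xpredT V); apply: v_sum.
  rewrite map_inj_in_uniq ?filter_uniq // => i j.
  rewrite !mem_filter => /andP[Pk _] /andP[Pj _]; exact: Pi.
by apply: lerD; apply: part => i j; rewrite /in_mem /=; lia.
Qed.

(** The condition says that k lies between 0 and n, so k is determined by its absolute value and the
    sum is part of the one-sided convolution at |n|. *)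
Lemma sum_between_le (n : int) (s : seq int) : uniq s ->
  \sum_(k <- s | (`|k| + `|n - k| == `|n|)%N) V `|k| * V `|n - k| <= C * V `|n|.
Proof.
move=> us.
have -> : \sum_(k <- s | (`|k| + `|n - k| == `|n|)%N) V `|k| * V `|n - k| =
    \sum_(k <- [seq k <- s | (`|k| + `|n - k| == `|n|)%N]) V `|k| * V (`|n| - `|k|)%N.
  rewrite big_filter; apply: eq_bigr => k /eqP h; congr (V _ * V _); lia.
rewrite -(big_map absz xpredT (fun j => V j * V (`|n| - j)%N)).
apply: le_trans (v_conv `|n|); apply: ler_sum_subseq.
- rewrite map_inj_in_uniq ?filter_uniq // => i j.
  rewrite !mem_filter => /andP[/eqP h1 _] /andP[/eqP h2 _]; lia.
- exact: iota_uniq.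
- move=> j /mapP [k]; rewrite mem_filter mem_iota => /andP[/eqP h _] ->; lia.
by move=> j; rewrite mulr_ge0.
Qed.

Let D := 4 * (K `^ q * W) + C.

(** If k is not between 0 and n, then |k| or |n - k| is at least |n|. Almost monotonicity bounds
    that factor by K^q V(|n|), and the other factor has sum at most 2 W. *)
Lemma symmetric_convolution (n : int) (s : seq int) : uniq s ->
  \sum_(k <- s) V `|k| * V `|n - k| <= D * V `|n|.
Proof.
move=> us; have Kq : 0 <= K `^ q by exact: powR_ge0.
apply: (@le_trans _ _ (\sum_(k <- s) K `^ q * V `|n| * (V `|k| + V `|n - k|) +
    \sum_(k <- s | (`|k| + `|n - k| == `|n|)%N) V `|k| * V `|n - k|)).
  rewrite [X in _ <= _ + X]big_mkcond -big_split; apply: ler_sum => k _ /=.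
  have P0 : 0 <= K `^ q * V `|n| by rewrite mulr_ge0.
  have P1 : 0 <= K `^ q * V `|n| * V `|k| by rewrite mulr_ge0.
  have P2 : 0 <= K `^ q * V `|n| * V `|n - k| by rewrite mulr_ge0.
  have P3 : 0 <= V `|k| * V `|n - k| by rewrite mulr_ge0.
  have [h|h] := leqP `|n| `|k|.
    have := ler_wpM2r (V_ge0 `|n - k|) (V_le h).
    by case: ifP; lra.
  have [h'|h'] := leqP `|n| `|n - k|.
    have := ler_wpM2l (V_ge0 `|k|) (V_le h').
    by case: ifP; lra.
  by have -> : (`|k| + `|n - k| == `|n|)%N; [lia|lra].
rewrite /D mulrDl; apply: lerD; last exact: sum_between_le.
rewrite -mulr_sumr big_split /=.
have h1 := sum_absz_le us.
have inj : injective (fun k : int => n - k) by move=> i j /addrI/oppr_inj.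
have h2 := sums_le_inj inj sum_absz_le us.
have -> : 4 * (K `^ q * W) * V `|n| = K `^ q * V `|n| * (2 * W + 2 * W) by ring.
by rewrite ler_wpM2l ?lerD // mulr_ge0.
Qed.

Definition symmetric_weight (c : R) (n : int) := c * v `|n|.

(** With cancellation, |m + n| is at most |m| or |n| and almost monotonicity applies; otherwise |m +
    n| = |m| + |n|. *)
Lemma v_absD (m n : int) : v `|m + n| <= K * (v `|m| * v `|n|).
Proof.
have vv1 : v `|m| <= v `|m| * v `|n| by rewrite ler_peMr // ltW.
have vv2 : v `|n| <= v `|m| * v `|n| by rewrite ler_peMl // ltW.
have [h|h] := leqP `|m + n| `|m|.
  apply: le_trans (v_mono _ (absz m - absz (m + n)%R)) _.
  by rewrite subnKC // ler_pM2l.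
have [h'|h'] := leqP `|m + n| `|n|.
  apply: le_trans (v_mono _ (absz n - absz (m + n)%R)) _.
  by rewrite subnKC // ler_pM2l.
have -> : `|(m + n)%R|%N = (`|m| + `|n|)%N by lia.
exact: v_mul.
Qed.

Lemma symmetric_weight_amaw : exists2 c, 1 <= c &
  almost_monotone_algebra_weight q (symmetric_weight c).
Proof.
have D0 : 0 <= D.
  have := symmetric_convolution 0 (isT : uniq [:: 0 : int]).
  rewrite big_seq1 subrr /= => h.
  have V0 : 0 < V 0%N by rewrite powR_gt0.
  by rewrite -(pmulr_lge0 _ V0); apply: le_trans h; rewrite mulr_ge0.
(* Scaling absorbs three constants: c >= 1 keeps the weight above 1, c >= K makes it
   submultiplicative, and c^q >= D reduces the convolution constant to 1. *)
pose c := 1 + K + D `^ q^-1.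
have Dq : 0 <= D `^ q^-1 by exact: powR_ge0.
have K0 : 0 < K by [].

have c1 : 1 <= c by rewrite /c; lra.
have c0 : 0 < c by exact: lt_le_trans ltr01 c1.
have cK : K <= c by rewrite /c; lra.
have cD : D <= c `^ q.
  have -> : D = (D `^ q^-1) `^ q by rewrite -powRrM mulVf ?gt_eqF // powRr1.
  by apply: ge0_ler_powR; rewrite ?nnegrE ?(ltW q_gt0) ?(ltW c0) // /c; lra.
have E n : symmetric_weight c n `^ (- q) = c `^ (- q) * V `|n|.
  by rewrite /symmetric_weight powRM // ltW.
have mono (n k : int) : `|(n + k)%R|%N = (`|n| + `|k|)%N ->
    symmetric_weight c n <= K * symmetric_weight c (n + k).
  by move=> h; rewrite /symmetric_weight h mulrCA ler_pM2l.
exists c => //; split.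
- split=> [n|m n].
    by rewrite /symmetric_weight -[leLHS]mulr1 ler_pM.
  rewrite /symmetric_weight -mulrA ler_pM2l //.
  apply: le_trans (v_absD m n) _.
  rewrite [leRHS]mulrCA ler_wpM2r // mulr_ge0 // ltW //.
- split=> [n|].
    apply: sums_le_esum => s us.
    have -> : \sum_(k <- s) symmetric_weight c k `^ (- q) * symmetric_weight c (n - k) `^ (- q) =
        c `^ (- q) * (c `^ (- q) * \sum_(k <- s) V `|k| * V `|n - k|).
      by rewrite !mulr_sumr; apply: eq_bigr => k _; rewrite !E; ring.
    rewrite E ler_wpM2l ?powR_ge0 //.
    apply: le_trans (ler_wpM2l (powR_ge0 _ _) (symmetric_convolution n us)) _.
    rewrite mulrA ler_piMl // powRN mulrC ler_pdivrMr ?mul1r //.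
    by rewrite powR_gt0.
  apply: le_lt_trans (ltry (c `^ (- q) * (2 * W))).
  apply: sums_le_esum; apply: sums_leS (sums_leM (powR_ge0 _ _) sum_absz_le) => n.
  by rewrite E.
- by move=> _; exists K => // n k n0 k0; apply: mono; lia.
by move=> _; exists K => // n k n0 k0; apply: mono; lia.
Qed.

End SymmetricWeight.

(** * Growth rates of submultiplicative sequences *)

Section GrowthRates.
Variable R : realType.
Implicit Types (w : int -> R) (r q : R).

(** Fekete's argument: write n = k m + j with j < m; the k blocks contribute at most r^(k m), and x
    j is bounded independently of n. *)
Lemma submultiplicative_growth (x : nat -> R) r : (forall n, 1 <= x n) ->
  (forall m n, x (m + n)%N <= x m * x n) -> 0 < r ->
  (exists2 m, (0 < m)%N & x m <= r ^+ m) -> 1 <= r ->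
  exists C, forall n, x n <= C * r ^+ n.
Proof.
move=> x1 xM r0 [m m0 xm] r1.
have x0 n : 0 <= x n by exact: le_trans ler01 (x1 n).
have xj j : x j <= x 0%N * x 1%N ^+ j.
  elim: j => [|j IH]; first by rewrite expr0 mulr1.
  rewrite -addn1; apply: le_trans (xM _ _) _.
  by rewrite addn1 exprSr mulrA ler_wpM2r.
exists (x 0%N * x 1%N ^+ m) => n; rewrite (divn_eq n m) exprD.
have key k j : x (k * m + j)%N <= r ^+ (k * m) * x j.
  elim: k => [|k IH]; first by rewrite mul0n expr0 mul1r.
  rewrite mulSn -addnA exprD; apply: le_trans (xM _ _) _.
  by rewrite -mulrA; apply: ler_pM.
apply: le_trans (key _ _) _; rewrite mulrCA ler_wpM2l ?exprn_ge0 ?(ltW r0) //.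
apply: le_trans (xj _) _; rewrite -[leLHS]mulr1; apply: ler_pM => //.
- by rewrite mulr_ge0 // exprn_ge0.
- rewrite ler_wpM2l //; apply: ler_weXn2l; [exact: x1|exact: ltnW (ltn_pmod n m0)].
by rewrite exprn_ege1.
Qed.

Lemma powR_inv_natK (a : R) n : 0 <= a -> (0 < n)%N -> (a `^ n%:R^-1) ^+ n = a.
Proof.
move=> a0 n0; rewrite -powR_mulrn ?powR_ge0 // -powRrM mulVf ?powRr1 //.
by rewrite pnatr_eq0 -lt0n.
Qed.

Lemma rho2_eq1 w r : weight w -> rho2 w = 1 -> 1 < r ->
  exists2 m, (0 < m)%N & w m%:Z <= r ^+ m.
Proof.
move=> [w1 _] rho r1; apply: contrapT => h.
suff : r <= rho2 w by rewrite rho leNgt r1.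
apply: lb_le_inf; first by exists (w 1%:Z `^ 1%:R^-1), 1%N.
move=> _ [n n0 <-]; rewrite leNgt; apply/negP => hlt; apply: h; exists n => //.
have w0 : 0 <= w n by exact: le_trans ler01 (w1 n).
by rewrite -(powR_inv_natK w0 n0) lerXn2r ?nnegrE ?powR_ge0 ?(ltW hlt) // (le_trans ler01 (ltW r1)).
Qed.

(** As w >= 1, the infimum [rho2 w] is at least 1, hence greater than 1, and it serves as [r]
    itself. *)
Lemma rho2_neq1 w : weight w -> rho2 w <> 1 ->
  exists2 r, 1 < r & forall n : nat, r ^+ n <= w n%:Z.
Proof.
move=> [w1 _] rho; have e0 : rho2 w >= 1.
  apply: lb_le_inf; first by exists (w 1%:Z `^ 1%:R^-1), 1%N.
  move=> _ [n n0 <-]; apply: (@le_trans _ _ (1 `^ n%:R^-1)); first by rewrite powR1.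
  by apply: ge0_ler_powR; rewrite ?nnegrE ?invr_ge0 // (le_trans ler01 (w1 n)).
have e1 : 1 < rho2 w by rewrite lt_neqAle e0 andbT eq_sym; apply/eqP.
exists (rho2 w) => // -[|n]; first by rewrite expr0.
have w0 : 0 <= w n.+1 by exact: le_trans ler01 (w1 _).
rewrite -(powR_inv_natK w0 (ltn0Sn n)).
rewrite lerXn2r ?nnegrE ?powR_ge0 ?(le_trans ler01 e0) //.
apply: ge_inf; last by exists n.+1.
by exists 0 => _ [m _ <-]; exact: powR_ge0.
Qed.

Lemma rho1_eq1 w r : weight w -> rho1 w = 1 -> 1 < r ->
  exists2 m, (0 < m)%N & w (- m%:Z) <= r ^+ m.
Proof.
move=> [w1 _] rho r1; apply: contrapT => h.
have r0 : 0 < r by exact: lt_trans r1.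
suff : rho1 w <= r^-1 by rewrite rho leNgt invf_lt1 ?r1.
apply: ge_sup; first by exists (w (- 1%:Z) `^ (- 1%:R^-1)), 1%N.
move=> _ [n n0 <-]; rewrite leNgt powRN; apply/negP => hlt; apply: h; exists n => //.
have w0 : 0 < w (- n%:Z) by exact: lt_le_trans ltr01 (w1 _).
rewrite -(powR_inv_natK (ltW w0) n0) lerXn2r ?nnegrE ?powR_ge0 ?(ltW r0) //.
by rewrite -[leLHS]invrK -[leRHS]invrK lef_pV2 ?posrE ?invr_gt0 ?powR_gt0 // ltW.
Qed.

(** As w >= 1, the supremum [rho1 w] lies in (0, 1), and its inverse serves as [r]. *)
Lemma rho1_neq1 w : weight w -> rho1 w <> 1 ->
  exists2 r, 1 < r & forall n : nat, r ^+ n <= w (- n%:Z).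
Proof.
move=> [w1 _] rho; pose E := [set w (- n%:Z) `^ (- n%:R^-1) | n in [set n : nat | (0 < n)%N]].
have ubE : ubound E 1.
  move=> _ [n n0 <-]; rewrite powRN invf_le1.
    apply: (@le_trans _ _ (1 `^ n%:R^-1)); first by rewrite powR1.
    by apply: ge0_ler_powR; rewrite ?nnegrE ?invr_ge0 // (le_trans ler01 (w1 _)).
  by rewrite powR_gt0 // (lt_le_trans ltr01 (w1 _)).
have E1 : E (w (- 1%:Z) `^ (- 1%:R^-1)) by exists 1%N.
have s1 : rho1 w <= 1 by apply: ge_sup => //; exists (w (- 1%:Z) `^ (- 1%:R^-1)).
have {}s1 : rho1 w < 1 by rewrite lt_neqAle s1 andbT; apply/eqP.
have ub x : E x -> x <= rho1 w by move=> Ex; apply: ub_le_sup => //; exists 1.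
have s0 : 0 < rho1 w.
  by apply: lt_le_trans (ub _ E1); rewrite powR_gt0 // (lt_le_trans ltr01 (w1 _)).
exists (rho1 w)^-1; first by rewrite invf_gt1.
case=> [|n]; first by rewrite expr0.
have w0 : 0 < w (- n.+1%:Z) by exact: lt_le_trans ltr01 (w1 _).
rewrite -(powR_inv_natK (ltW w0) (ltn0Sn n)).
rewrite lerXn2r ?nnegrE ?powR_ge0 ?invr_ge0 ?(ltW s0) //.
rewrite -[leRHS]invrK lef_pV2 ?posrE ?invr_gt0 ?powR_gt0 // -powRN.
by apply: ub; exists n.+1.
Qed.

Lemma admissible_subexponential w : weight w -> admissible w -> subexponential w.
Proof.
move=> hw [h1 h2] r r1; have [w1 wM] := hw; have r0 : 0 < r := lt_trans ltr01 r1.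
have [||C1 hC1] := @submultiplicative_growth (fun n => w n%:Z) r _ _ r0
  (rho2_eq1 hw h2 r1) (ltW r1) => //.
  by move=> m n; rewrite PoszD.
have [||C2 hC2] := @submultiplicative_growth (fun n => w (- n%:Z)) r _ _ r0
  (rho1_eq1 hw h1 r1) (ltW r1) => //.
  by move=> m n; rewrite PoszD opprD.
exists (Num.max C1 C2) => n; split.
  by apply: le_trans (hC1 n) _; rewrite ler_wpM2r ?exprn_ge0 ?(ltW r0) // le_max lexx.
by apply: le_trans (hC2 n) _; rewrite ler_wpM2r ?exprn_ge0 ?(ltW r0) // le_max lexx orbT.
Qed.

End GrowthRates.

(** * Subexponential weights below a non-admissible weight *)

Section DominatedWeight.
Variable R : realType.
Implicit Types (w : int -> R) (r q : R).

(** The symmetry of [nu] makes this property invariant under reflection of [w]. *)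
Definition dominated_weight q w := exists nu : int -> R,
  [/\ almost_monotone_algebra_weight q nu, subexponential nu,
      forall n, nu (- n) = nu n &
      exists2 K : R, 0 < K & forall n, 1 <= nu n /\ nu n <= K * w n].

(** The positive half of [w] is subexponential and is copied to the negative half, where w(n) <= C
    r^n <= C w(-n) keeps the copy below a multiple of [w]. *)
Lemma dominated_one_sided q w K W r : 0 < q -> weight w ->
  (forall n (s : seq int), uniq s ->
    \sum_(k <- s) w k `^ (- q) * w (n - k) `^ (- q) <= w n `^ (- q)) ->
  sums_le (fun n => w n `^ (- q)) W ->
  (forall n k : int, 0 < n -> 0 < k -> w n <= K * w (n + k)) -> 0 < K ->
  (forall r, 1 < r -> exists C, forall n : nat, w n%:Z <= C * r ^+ n) ->
  1 < r -> (forall n : nat, r ^+ n <= w (- n%:Z)) ->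
  dominated_weight q w.
Proof.
move=> q0 hw wconv wsum wmono K0 wexp r1 wr; have [w1 wM] := hw.
have w0 n : 0 < w n by exact: lt_le_trans ltr01 (w1 n).
pose v (n : nat) := w n%:Z.
(* [K] covers positive arguments only; the summand 1 covers a zero increment, and [w 0] the start at
   0. *)
pose K' := 1 + K + w 0.
have K'0 : 0 < K' by rewrite !addr_gt0.
have K'1 : 1 <= K' by rewrite /K' -addrA lerDl addr_ge0 // ltW.
have [|||||c c1 hc] := @symmetric_weight_amaw R q v K' 1 W q0 K'0.
- by move=> n; exact: w1.
- move=> m n; rewrite /v PoszD; apply: le_trans (wM _ _) _.
  by rewrite ler_peMl // mulr_ge0 // ltW.
- move=> [|n] [|k]; rewrite /v.
  + by rewrite addn0 ler_peMl // ltW.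
  + apply: (@le_trans _ _ K'); first by rewrite /K' lerDr addr_ge0 // ltW.
    by rewrite ler_peMr // ltW.
  + by rewrite addn0 ler_peMl // ltW.
  rewrite PoszD; apply: le_trans (wmono n.+1 k.+1 isT isT) _.
  rewrite ler_wpM2r ?(ltW (w0 _)) // /K' addrAC lerDr addr_ge0 // ltW //.
- move=> n; rewrite mul1r.
  have inj : injective Posz by move=> i j [].
  have us : uniq [seq Posz k | k <- iota 0 n.+1] by rewrite map_inj_uniq ?iota_uniq.
  apply: le_trans (wconv n _ us); rewrite big_map le_eqVlt; apply/orP; left; apply/eqP.
  apply: eq_big_seq => k; rewrite mem_iota => hk.
  by congr (_ * w _ `^ _); lia.
- by move=> s us; apply: (sums_le_inj _ wsum us) => i j [].
exists (symmetric_weight v c); split=> //.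
  move=> s s1; have [C hC] := wexp s s1; exists (c * C) => n.
  have h : c * w n <= c * C * s ^+ n by rewrite -mulrA ler_wpM2l // (le_trans ler01 c1).
  by rewrite /symmetric_weight /v abszN.
  by move=> n; rewrite /symmetric_weight abszN.
have [C hC] := wexp r r1.
have C0 : 0 < C by have := lt_le_trans (w0 0) (hC 0%N); rewrite expr0 mulr1.
have c0 : 0 < c by exact: lt_le_trans ltr01 c1.
exists (c * (C + 1)); first by rewrite mulr_gt0 // addr_gt0.
move=> n; split; first by case: hc => [[]].
rewrite /symmetric_weight -mulrA ler_pM2l // /v.
case: n => n; first by rewrite ler_peMl ?(ltW (w0 _)) // lerDr ltW.
rewrite NegzE abszN absz_nat; apply: le_trans (hC _) _.
apply: ler_pM; rewrite ?exprn_ge0 ?(ltW C0) ?(ltW (lt_trans ltr01 r1)) //.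
by rewrite lerDl.
Qed.

(** Bernoulli's inequality for sqrt r = 1 + h gives n + 1 <= (1 + 1/h) (sqrt r)^n, which is then
    squared. *)
Lemma square_le_exp r : 1 < r -> exists C, forall n : nat, (n.+1%:R ^+ 2 : R) <= C * r ^+ n.
Proof.
move=> r1; have r0 : 0 <= r by exact: le_trans ler01 (ltW r1).
pose h := Num.sqrt r - 1.
have h0 : 0 < h by rewrite subr_gt0 -sqrtr1 ltr_sqrt // (lt_trans ltr01).
have sE : Num.sqrt r = 1 + h by rewrite /h addrC subrK.
have bern n : 1 + n%:R * h <= (1 + h) ^+ n.
  elim: n => [|n IH]; first by rewrite mul0r addr0 expr0.
  rewrite exprS; have n0 : 0 <= n%:R :> R by [].
  apply: (@le_trans _ _ ((1 + h) * (1 + n%:R * h))); last by rewrite ler_wpM2l // addr_ge0 // ltW.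
  have : 0 <= n%:R * h * h by rewrite !mulr_ge0 // ltW.
  rewrite -natr1; lra.
have hi : 0 < h^-1 by rewrite invr_gt0.
exists ((1 + h^-1) ^+ 2) => n; rewrite -[X in _ * X ^+ n](sqr_sqrtr r0) exprAC -exprMn.
rewrite ler_sqr ?nnegrE ?mulr_ge0 ?exprn_ge0 ?sqrtr_ge0 ?addr_ge0 ?(ltW hi) //.
rewrite sE; apply: (@le_trans _ _ ((1 + h^-1) * (1 + n%:R * h))).
  have -> : (1 + h^-1) * (1 + n%:R * h) = 1 + n%:R * h + h^-1 + n%:R by field; rewrite gt_eqF.
  have nh : 0 <= n%:R * h by rewrite mulr_ge0 // ltW.
  rewrite -natr1; lra.
by rewrite ler_wpM2l // addr_ge0 // ltW.
Qed.

(** A polynomial weight lies below a multiple of [w]. The choice (n + 1)^2 is increasing and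
    submultiplicative, its power -q is summable, and v n <= 4 v k for n <= 2 k yields the
    convolution bound. *)
Lemma dominated_exponential q w r : 1 < q -> 1 < r ->
  (forall n : nat, r ^+ n <= w n%:Z /\ r ^+ n <= w (- n%:Z)) ->
  dominated_weight q w.
Proof.
move=> q1 r1 wr; have q0 : 0 < q := lt_trans ltr01 q1.
pose v (n : nat) : R := n.+1%:R ^+ 2.
have v1 n : 1 <= v n by rewrite exprn_ege1 // ler1n.
have v0 n : 0 < v n by exact: lt_le_trans ltr01 (v1 n).
have vmono m n : (m <= n)%N -> v m <= v n.
  by move=> mn; rewrite /v lerXn2r ?nnegrE // ler_nat.
have vsum : sums_le (fun n => v n `^ (- q)) 2.
  (* Telescoping with (a + 1)^-2 <= a^-1 - (a + 1)^-1, after v^-q <= v^-1. *)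
  have part N : \sum_(n <- iota 0 N.+1) v n `^ (- q) <= 2 - N.+1%:R^-1.
    have term n : v n `^ (- q) <= (v n)^-1.
      by rewrite powRN lef_pV2 ?posrE ?powR_gt0 // le1r_powR // ltW.
    elim: N => [|N IH].
      rewrite big_seq1; apply: le_trans (term _) _.
      by rewrite /v expr1n invr1; lra.
    rewrite -addn1 iotaD big_cat big_seq1 /=.
    apply: le_trans (lerD IH (term _)) _.
    have a0 : 0 < N.+1%:R :> R by [].
    have b0 : 0 < N.+2%:R :> R by [].
    rewrite /v add0n addn1.
    have -> : N.+2%:R = N.+1%:R + 1 :> R by rewrite natr1.
    move: N.+1%:R a0 => a a0 {b0 IH term}.
    have : a^-1 - (a + 1)^-1 - ((a + 1) ^+ 2)^-1 = (a * (a + 1) ^+ 2)^-1.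
      by field; rewrite !gt_eqF // addr_gt0.
    have : 0 < (a * (a + 1) ^+ 2)^-1 by rewrite invr_gt0 mulr_gt0 // exprn_gt0 // addr_gt0.
    lra.
  move=> s us; apply: (@le_trans _ _ (\sum_(n <- iota 0 (\max_(i <- s) i).+1) v n `^ (- q))).
    apply: ler_sum_subseq => //; first exact: iota_uniq.
      move=> i si; rewrite mem_iota add0n ltnS /=.
      by rewrite (@leq_bigmax_seq _ _ xpredT (fun i => i) i si isT).
    by move=> i; exact: powR_ge0.
  by apply: le_trans (part _) _; rewrite gerBl invr_ge0.
(* The larger of k and n - k is at least n / 2, so its term is at most 4^q times that of n; the
   remaining terms form two sums of at most 2 each. *)
pose C : R := 4 `^ q * 4.
have [||||c c1 hc] := @symmetric_weight_amaw R q v 1 C 2 q0 ltr01 v1.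
- move=> m n; rewrite mul1r /v -exprMn lerXn2r ?nnegrE ?mulr_ge0 //.
  rewrite -natrM ler_nat; lia.
- by move=> m n; rewrite mul1r vmono // leq_addr.
- move=> n; rewrite /C -mulrA mulrCA.
  have half k : (n <= k.*2)%N -> v k `^ (- q) <= 4 `^ q * v n `^ (- q).
    move=> nk; rewrite !powRN ler_pdivlMr ?powR_gt0 // mulrC ler_pdivrMr ?powR_gt0 //.
    rewrite -powRM ?(ltW (v0 _)) //.
    apply: ge0_ler_powR; rewrite ?nnegrE ?(ltW q0) ?(ltW (v0 _)) //.
      by rewrite mulr_ge0 // ltW.
    have -> : 4 = 2 ^+ 2 :> R by ring.
    rewrite /v -exprMn lerXn2r ?nnegrE ?mulr_ge0 //.
    rewrite -natrM ler_nat; lia.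
  have V0 k : 0 <= v k `^ (- q) by exact: powR_ge0.
  have Q0 : 0 <= 4 `^ q * v n `^ (- q) by rewrite mulr_ge0 ?powR_ge0.
  apply: (@le_trans _ _ (\sum_(k <- iota 0 n.+1)
      4 `^ q * v n `^ (- q) * (v k `^ (- q) + v (n - k)%N `^ (- q)))).
    rewrite big_seq [leRHS]big_seq; apply: ler_sum => k; rewrite mem_iota => hk.
    have P1 : 0 <= 4 `^ q * v n `^ (- q) * v k `^ (- q) by rewrite mulr_ge0.
    have P2 : 0 <= 4 `^ q * v n `^ (- q) * v (n - k)%N `^ (- q) by rewrite mulr_ge0.
    have [h|h] := leqP n k.*2.
      have := ler_wpM2r (V0 (n - k)%N) (half _ h); lra.
    have h' : (n <= (n - k).*2)%N by lia.
    have := ler_wpM2l (V0 k) (half _ h'); lra.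
  rewrite -mulr_sumr big_split /=.
  have h1 := vsum _ (iota_uniq 0 n.+1).
  have h2 : \sum_(k <- iota 0 n.+1) v (n - k)%N `^ (- q) <= 2.
    rewrite -(big_map (fun k => n - k)%N xpredT (fun k => v k `^ (- q))).
    apply: vsum; rewrite map_inj_in_uniq ?iota_uniq // => i j.
    rewrite !mem_iota; lia.
  rewrite [leRHS]mulrC ler_wpM2l //; lra.
- exact: vsum.
have c0 : 0 < c by exact: lt_le_trans ltr01 c1.
exists (symmetric_weight v c); split=> //.
  move=> s s1; have [D hD] := square_le_exp s1; exists (c * D) => n.
  have h : c * v n <= c * D * s ^+ n by rewrite -mulrA ler_wpM2l ?(ltW c0) //; exact: hD.
  by rewrite /symmetric_weight abszN.
  by move=> n; rewrite /symmetric_weight abszN.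
have [D hD] := square_le_exp r1.
have D0 : 0 < D by have := lt_le_trans (v0 0%N) (hD 0%N); rewrite expr0 mulr1.
exists (c * D); first exact: mulr_gt0.
move=> n; split; first by case: hc => [[]].
rewrite /symmetric_weight -mulrA ler_pM2l //; apply: le_trans (hD _) _.
rewrite ler_pM2l //; case: n => n; first exact: (wr n).1.
by rewrite NegzE abszN absz_nat; exact: (wr n.+1).2.
Qed.

End DominatedWeight.

Lemma dominated_nonadmissible (R : realType) (q : R) (w : int -> R) : 1 < q ->
  almost_monotone_algebra_weight q w -> ~ admissible w -> dominated_weight q w.
Proof.
move=> q1 [hw [wconv wfin] mono1 mono2] nadm; have q0 : 0 < q := lt_trans ltr01 q1.
have conv n (s : seq int) : uniq s ->
    \sum_(k <- s) w k `^ (- q) * w (n - k) `^ (- q) <= w n `^ (- q).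
  by move=> us; exact: (esum_le_sums (wconv n) us).
have [W hW] := esum_lty_sums (fun n => powR_ge0 (w n) (- q)) wfin.
have [w1 wM] := hw.
have [h1|h1] := pselect (rho1 w = 1); have [h2|h2] := pselect (rho2 w = 1).
- by exfalso; exact: nadm.
(* Exponential growth at +oo only: the reflected weight falls under the one-sided case, and the
   symmetry of [nu] undoes the reflection. *)
- have [r r1 wr] := rho2_neq1 hw h2; have [K K0 hK] := mono1 h1.
  pose w' n := w (- n).
  have hw' : weight w'.
    by split=> [n|m n]; rewrite /w' ?opprD; [exact: w1|exact: wM].
  have hconv' n (s : seq int) : uniq s ->
      \sum_(k <- s) w' k `^ (- q) * w' (n - k) `^ (- q) <= w' n `^ (- q).
    move=> us; have us' : uniq [seq - k | k <- s].
      by rewrite map_inj_uniq //; exact: oppr_inj.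
    have := conv (- n) _ us'; rewrite big_map /w'.
    by apply: le_trans; apply: ler_sum => k _; rewrite opprB opprK addrC.
  have hsum' : sums_le (fun n => w' n `^ (- q)) W.
    by move=> s us; exact: (sums_le_inj oppr_inj hW us).
  have hmono' n k : 0 < n -> 0 < k -> w' n <= K * w' (n + k).
    by move=> n0 k0; rewrite /w' opprD hK // oppr_lt0.
  have hexp' s : 1 < s -> exists C, forall n : nat, w' n%:Z <= C * s ^+ n.
    move=> s1; apply: submultiplicative_growth (lt_trans ltr01 s1) _ (ltW s1).
    - by move=> n; exact: w1.
    - by move=> m n; rewrite PoszD /w' opprD.
    - exact: rho1_eq1.
  have hr' (n : nat) : r ^+ n <= w' (- n%:Z) by rewrite /w' opprK.
  have [nu [h3 h4 sym [L L0 hL]]] := dominated_one_sided q0 hw' hconv' hsum' hmono' K0 hexp' r1 hr'.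
  exists nu; split => //; exists L => // n.
  by split; [exact: (hL n).1|rewrite -sym; have := (hL (- n)).2; rewrite /w' opprK].
- have [r r1 wr] := rho1_neq1 hw h1; have [K K0 hK] := mono2 h2.
  apply: (dominated_one_sided q0 hw conv hW _ K0 _ r1 wr).
    by move=> n k n0 k0; apply: hK; exact: ltW.
  move=> s s1; apply: submultiplicative_growth (lt_trans ltr01 s1) _ (ltW s1).
  - by move=> n; exact: w1.
  - by move=> m n; rewrite PoszD.
  - exact: rho2_eq1.
have [r r1 wr] := rho1_neq1 hw h1; have [r' r1' wr'] := rho2_neq1 hw h2.
have m1 : 1 < Num.min r r' by rewrite lt_min r1.
have m0 : 0 <= Num.min r r' := le_trans ler01 (ltW m1).
apply: (dominated_exponential q1 m1) => n; split.
  apply: le_trans (wr' n); rewrite lerXn2r ?nnegrE ?(le_trans ler01 (ltW r1')) //.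
  by rewrite ge_min lexx orbT.
apply: le_trans (wr n); rewrite lerXn2r ?nnegrE ?(le_trans ler01 (ltW r1)) //.
by rewrite ge_min lexx.
Qed.

Lemma abs_conv_fourier_dominated (R : realType) (A : banachAlgebra R) (p K : R)
    (w nu : int -> R) (f : R[i] -> A) : 0 <= p -> 0 <= K ->
  (forall n, 0 <= w n) -> (forall n, 0 <= nu n <= K * w n) ->
  abs_conv_fourier p w f -> abs_conv_fourier p nu f.
Proof.
move=> p0 K0 w0 hnu [fc fs]; split => //.
have [C hC] : exists C, sums_le (fun n => rnorm (fourier_coef f n) `^ p * w n `^ p) C.
  by apply: esum_lty_sums fs => n; rewrite mulr_ge0 ?powR_ge0.
apply: le_lt_trans (ltry (K `^ p * C)); apply: sums_le_esum.
apply: sums_leS (sums_leM (powR_ge0 K p) hC) => n.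
have /andP[nu0 nuw] := hnu n.
rewrite mulrCA ler_wpM2l ?powR_ge0 // -powRM //.
by apply: ge0_ler_powR; rewrite ?nnegrE // mulr_ge0.
Qed.

Theorem theorem2 (R : realType) (p q : R) (p_gt1 : 1 < p)
    (pq : p^-1 + q^-1 = 1) (w : int -> R)
    (w_amaw : almost_monotone_algebra_weight q w)
    (A : banachAlgebra R) (f : R[i] -> A)
    (f_cont : continuous_on_circle f)
    (f_fourier : abs_conv_fourier p w f)
    (s : side)
    (f_inv : forall z, circle z -> exists b : A, is_inverse s (f z) b) :
  (exists (nu : int -> R) (g : R[i] -> A),
     [/\ almost_monotone_algebra_weight q nu,
         continuous_on_circle g,
         exists2 K : R, 0 < K & forall n, 1 <= nu n /\ nu n <= K * w n,
         abs_conv_fourier p nu g &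
         forall z, circle z -> is_inverse s (f z) (g z)]) /\
  (admissible w ->
     exists g : R[i] -> A,
       [/\ continuous_on_circle g,
           abs_conv_fourier p w g &
           forall z, circle z -> is_inverse s (f z) (g z)]).
Proof.
have [hw _ _ _] := w_amaw; have [w1 _] := hw.
have adm : admissible w -> exists g : R[i] -> A,
    [/\ continuous_on_circle g, abs_conv_fourier p w g &
      forall z, circle z -> is_inverse s (f z) (g z)].
  move=> hadm; apply: (inverse_subexponential p_gt1 pq w_amaw) => //.
  exact: admissible_subexponential.
split => //; have [hadm|nadm] := pselect (admissible w).
  have [g [g1 g2 g3]] := adm hadm; exists w, g; split => //.
  by exists 1 => // n; rewrite mul1r.
(* Since nu <= K w, the series of [f] converges absolutely for [nu] as well, and the inversion takes
   place there. *)
have [nu [nu_amaw nu_sub _ [K K0 hK]]] :=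
  dominated_nonadmissible (conj_exponent_gt1 p_gt1 pq) w_amaw nadm.
have f_nu : abs_conv_fourier p nu f.
  apply: (abs_conv_fourier_dominated (ltW (lt_trans ltr01 p_gt1)) (ltW K0)) f_fourier.
    by move=> n; exact: le_trans ler01 (w1 n).
  by move=> n; have [h1 ->] := hK n; rewrite (le_trans ler01 h1).
have [g [g1 g2 g3]] := inverse_subexponential p_gt1 pq nu_amaw nu_sub f_nu f_inv.
by exists nu, g; split => //; exists K.
Qed.
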